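(* Let $G,H$ be locally compact, second countable, Hausdorff, unimodular groups and let $\mathrm{Del}_*$ be the space of Delone sets in $G\times H$ with fixed parameters. Let $\Omega\in\mathcal{I}_{G\times H}(\mathrm{Del}_* )$ be uniquely ergodic with measure $\mu$, and let $\mathfrak{v}\in C_c(H)$ be a continuous window function. If $(\Omega_l,\mu_l,G)$, $l\in\mathbb{N}$, are Delone dynamical systems with $\Omega_l\in\mathcal{I}_{G\times H}(\mathrm{Del}_* )$ such that $\Omega_l\to\Omega$ in the Chabauty-Fell topology, then $$\lim_{l\to\infty}\gamma_{\Omega_l,\mathfrak{v},\mu_l}=\gamma_{\Omega,\mathfrak{v}}$$ in the weak-$*$ topology of Radon measures on $G$.
   Context: Chabauty-Fell topology: for a locally compact, second countable, Hausdorff space $Z$, the set $\mathcal{C}(Z)$ of closed subsets of $Z$ carries the topology with basis $\{Y\in\mathcal{C}(Z): C\cap Y=\emptyset,\ O\cap Y\ne\emptyset\ \forall O\in\mathcal{O}\}$, $C\subseteq Z$ compact, $\mathcal{O}$ a finite family of open sets. Delone sets: fix an open neighborhood $U$ of the identity in $G\times H$ and a compact $K\subseteq G\times H$. $\mathrm{Del}_*$ is the set of non-empty $D\subseteq G\times H$ with $\#(xU\cap D)\le1$ for all $x\in G\times H$ and $D\cdot K=G\times H$; it is a compact subspace of $\mathcal{C}(G\times H)$. $G\times H$ acts on it by left translation and $G$ acts via $gD:=(g,e_H)D$. $\mathcal{I}_{G\times H}(\mathrm{Del}_* )$ is the set of non-empty, closed, $G\times H$-invariant subsets of $\mathrm{Del}_*$,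 with the topology induced from $\mathcal{C}(\mathrm{Del}_* )$. A Delone dynamical system $(\Omega,\mu,G)$ is such an $\Omega$ with a $G$-invariant Borel probability measure $\mu$ on $\Omega$; $\Omega$ is uniquely ergodic (with measure $\mu$) if $\mu$ is the only $G$-invariant Borel probability measure on $\Omega$. A continuous window function is a continuous compactly supported $\mathfrak{v}:H\to[0,\infty)$. Let $\pi_G,\pi_H$ be the coordinate projections of $G\times H$. For $f\in C_c(G)$ the periodization is $\mathcal{P}_{\mathfrak{v}}f(D):=\sum_{x\in D}f(\pi_G(x))\,\mathfrak{v}(\pi_H(x))$, $D\in\mathrm{Del}_*$. On $C_c(G)$ put $f^*(g)=\overline{f(g^{-1})}$ and $(f_1*f_2)(g)=\int_G f_1(h)f_2(h^{-1}g)\,dm_G(h)$, $m_G$ the Haar measure. The $\mathfrak{v}$-weighted autocorrelation $\gamma_{\Omega,\mathfrak{v},\mu}$ of $(\Omega,\mu,G)$ is the unique positive definite Radon measure on $G$ with $\gamma_{\Omega,\mathfrak{v},\mu}(f_1^**f_2)=\int_\Omega\overline{\mathcal{P}_{\mathfrak{v}}f_1(D)}\,\mathcal{P}_{\mathfrak{v}}f_2(D)\,d\mu(D)$ for all $f_1,f_2\in C_c(G)$. If $\Omega$ is uniquely ergodic with measure $\mu$, one writes $\gamma_{\Omega,\mathfrak{v}}:=\gamma_{\Omega,\mathfrak{v},\mu}$. Weak-$*$ convergence of Radon measures on $G$ means convergence of integrals against all functions in $C_c(G)$. *)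

(* Defs.v *)
(* MathComp-Analysis *)
From HB Require Import structures.
From mathcomp Require Import all_boot all_order all_algebra.
From mathcomp Require Import all_classical all_reals all_analysis.
From mathcomp Require Import complex.

Set Implicit Arguments.
Unset Strict Implicit.
Unset Printing Implicit Defensive.

Import Order.TTheory GRing.Theory Num.Theory.
Import numFieldNormedType.Exports.

Local Open Scope classical_set_scope.
Local Open Scope ring_scope.

(** * Topological groups *)

(* The structure is pointed only because [measurableType] requires it; the
   distinguished point plays no role and need not be the identity. *)
HB.mixin Record isTopologicalGroup G & Group G & PointedTopological G :=
  { mulg_continuous : continuous (fun xy : G * G => (xy.1 * xy.2)%g) ;
    invg_continuous : continuous (fun x : G => (x^-1)%g) }.

#[short(type="topologicalGroupType")]
HB.structure Definition TopologicalGroup :=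
  { G of Group G & PointedTopological G & isTopologicalGroup G }.

Lemma continuous_mulg (T : topologicalType) (G : topologicalGroupType)
    (f g : T -> G) :
  continuous f -> continuous g -> continuous (fun t => f t * g t)%g.
Proof.
move=> cf cg t.
apply: (@cvg_comp _ _ _ (fun t => (f t, g t)) (fun xy : G * G => (xy.1 * xy.2)%g)
  _ (nbhs (f t, g t))); last exact: (@mulg_continuous G (f t, g t)).
by apply: cvg_pair; [exact: cf|exact: cg].
Qed.

Section product_group.
Variables G H : topologicalGroupType.

Let fst_continuous : continuous (@fst G H).
Proof. by move=> x; exact: cvg_fst. Qed.

Let snd_continuous : continuous (@snd G H).
Proof. by move=> x; exact: cvg_snd. Qed.

Let mul_pair_continuous :
  continuous (fun xy : (G * H) * (G * H) => (xy.1 * xy.2)%g).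
Proof.
move=> xy.
have cfst : continuous (@fst (G * H) (G * H)) by move=> x; exact: cvg_fst.
have csnd : continuous (@snd (G * H) (G * H)) by move=> x; exact: cvg_snd.
apply: (@cvg_pair _ _ _ _ (nbhs (xy.1.1 * xy.2.1)%g) (nbhs (xy.1.2 * xy.2.2)%g)).
- apply: (@continuous_mulg _ G (fun xy : (G * H) * (G * H) => xy.1.1)
    (fun xy => xy.2.1)) => p.
    exact: (@cvg_comp _ _ _ fst fst _ _ _ (cfst p) (@fst_continuous _)).
  exact: (@cvg_comp _ _ _ snd fst _ _ _ (csnd p) (@fst_continuous _)).
- apply: (@continuous_mulg _ H (fun xy : (G * H) * (G * H) => xy.1.2)
    (fun xy => xy.2.2)) => p.
    exact: (@cvg_comp _ _ _ fst snd _ _ _ (cfst p) (@snd_continuous _)).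
  exact: (@cvg_comp _ _ _ snd snd _ _ _ (csnd p) (@snd_continuous _)).
Qed.

Let inv_pair_continuous : continuous (fun x : G * H => (x^-1)%g).
Proof.
have c1 : continuous (fun x : G * H => (x.1^-1)%g).
  by move=> x; apply: continuous_comp (@fst_continuous x) _; exact: invg_continuous.
have c2 : continuous (fun x : G * H => (x.2^-1)%g).
  by move=> x; apply: continuous_comp (@snd_continuous x) _; exact: invg_continuous.
by move=> x; exact: (cvg_pair (c1 x) (c2 x)).
Qed.

HB.instance Definition _ := isTopologicalGroup.Build (G * H)%type
  mul_pair_continuous inv_pair_continuous.

End product_group.

Definition lcsc_hausdorff (T : topologicalType) : Prop :=
  [/\ locally_compact [set: T], @second_countable T & hausdorff_space T].

(** * Measures *)

Notation Borel X := (g_sigma_algebraType (@open X)).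

Definition radon (R : realType) (X : ptopologicalType)
    (m : {measure set (Borel X) -> \bar R}) : Prop :=
  [/\ forall C : set X, compact C -> (m C < +oo)%E,
      forall A : set X, measurable (A : set (Borel X)) ->
        m A = ereal_inf [set m O | O in [set O : set X | open O /\ A `<=` O]] &
      forall O : set X, open O ->
        m O = ereal_sup [set m C | C in [set C : set X | compact C /\ C `<=` O]]].

Definition left_haar (R : realType) (G : topologicalGroupType)
    (m : {measure set (Borel G) -> \bar R}) : Prop :=
  [/\ radon m, m [set: G] != 0%E &
      forall (g : G) (A : set G), measurable (A : set (Borel G)) ->
        m ((fun x => g * x)%g @^-1` A) = m A].

Definition unimodular (R : realType) (G : topologicalGroupType) : Prop :=
  forall m : {measure set (Borel G) -> \bar R}, left_haar m ->
  forall (g : G) (A : set G), measurable (A : set (Borel G)) ->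
    m ((fun x => x * g)%g @^-1` A) = m A.

Definition cintegral (R : realType) d (T : measurableType d)
    (m : {measure set T -> \bar R}) (f : T -> R[i]) : R[i] :=
  Complex (\int[m]_x complex.Re (f x)) (\int[m]_x complex.Im (f x)).

(** * The Chabauty-Fell topology *)

Record closedSet (Z : topologicalType) :=
  ClosedSet { cset :> set Z ; closed_cset : closed cset }.

Section chabauty_fell.
Variable Z : topologicalType.

HB.instance Definition _ := gen_eqMixin (closedSet Z).
HB.instance Definition _ := gen_choiceMixin (closedSet Z).

Definition fell_index : set (set Z * set (set Z)) :=
  [set i | [/\ compact i.1, finite_set i.2 & i.2 `<=` open]].

Definition fell_base (i : set Z * set (set Z)) : set (closedSet Z) :=
  [set Y | i.1 `&` cset Y = set0 /\ forall O, i.2 O -> O `&` cset Y !=set0].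

Let fell_cover : \bigcup_(i in fell_index) fell_base i = setT.
Proof.
rewrite -subTset => Y _; exists (set0, set0).
  by split => //=; exact: compact0.
by split => //=; rewrite set0I.
Qed.

Let fell_join i j Y : fell_index i -> fell_index j ->
  fell_base i Y -> fell_base j Y ->
  exists k, [/\ fell_index k, fell_base k Y &
                fell_base k `<=` fell_base i `&` fell_base j].
Proof.
move=> [c1 f1 o1] [c2 f2 o2] [d1 h1] [d2 h2].
exists (i.1 `|` j.1, i.2 `|` j.2); split.
- split => /=; [exact: compactU|by rewrite finite_setU|].
  by move=> O [/o1|/o2].
- split => /=; first by rewrite setIUl d1 d2 setU0.
  by move=> O [/h1|/h2].
- move=> X [/= d h]; rewrite setIUl in d.
  have /seteqP[dd _] := d; split; split.
  + by apply/seteqP; split => // x xX; apply: dd; left.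
  + by move=> O Oi; apply: h; left.
  + by apply/seteqP; split => // x xX; apply: dd; right.
  + by move=> O Oi; apply: h; right.
Qed.

HB.instance Definition _ :=
  isBaseTopological.Build (closedSet Z) fell_cover fell_join.

End chabauty_fell.

(** * Delone sets *)

Definition lact (L : topologicalGroupType) (x : L) (A : set L) : set L :=
  [set (x * y)%g | y in A].

Section delone.
Variables (L : topologicalGroupType) (U K : set L).

(* In a Hausdorff group with [U] an open neighborhood of the identity, a set
   meeting each translate of [U] in at most one point is closed, so that
   quantifying over [closedSet L] loses no Delone set. *)
Definition delone : set (closedSet L) :=
  [set D | [/\ cset D !=set0,
               forall x : L, is_subset1 (lact x U `&` cset D) &
               [set (x * k)%g | x in cset D & k in K] = [set: L]]].

Lemma closed_lact (x : L) (A : set L) : closed A -> closed (lact x A).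
Proof.
move=> cA; have -> : lact x A = (fun y => (x^-1 * y)%g) @^-1` A.
  apply/seteqP; split=> [_ [y Ay <-]|y Ay] /=; first by rewrite mulKg.
  by exists (x^-1 * y)%g => //; rewrite mulVKg.
apply: preimage_closed => //=.
by move=> y _; apply: continuous_mulg => z; [exact: cvg_cst|exact: cvg_id].
Qed.

Definition closedSet_act (x : L) (D : closedSet L) : closedSet L :=
  ClosedSet (@closed_lact x _ (@closed_cset _ D)).

Lemma delone_act_subproof (x : L) (D : delone) :
  closedSet_act x (val D) \in delone.
Proof.
have [[d Dd] sep rel] := set_mem (valP D); apply/mem_set; split => /=.
- by exists (x * d)%g, d.
- move=> y _ _ [[u Uu <-] [a Da au]] [[w Uw <-] [b Db bw]].
  rewrite -au -bw; congr (_ * _)%g; apply: (sep (x^-1 * y)%g); split => //.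
    by exists u => //; rewrite -mulgA -au mulKg.
  by exists w => //; rewrite -mulgA -bw mulKg.
- rewrite -subTset => z _.
  have : [set: L] (x^-1 * z)%g by [].
  rewrite -rel => -[a Da [k Kk ak]].
  exists (x * a)%g; first by exists a.
  by exists k => //; rewrite -mulgA ak mulVKg.
Qed.

Definition delone_act (x : L) (D : delone) : delone :=
  exist _ (closedSet_act x (val D)) (delone_act_subproof x D).

Definition invariant_closed : set (closedSet delone) :=
  [set Om | cset Om !=set0 /\
            forall (x : L) (D : delone), cset Om D -> cset Om (delone_act x D)].

End delone.

Arguments invariant_closed {L} U K _.

Definition points (L : topologicalGroupType) (U K : set L)
    (Om : invariant_closed U K) : Type := cset (val Om).

HB.instance Definition _ (L : topologicalGroupType) (U K : set L)
    (Om : invariant_closed U K) :=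
  Topological.copy (points Om) (cset (val Om)).

Lemma points_inhabited (L : topologicalGroupType) (U K : set L)
    (Om : invariant_closed U K) : {D : delone U K | D \in cset (val Om)}.
Proof. by apply: cid; have [[D OD] _] := set_mem (valP Om); exists D; exact: mem_set. Qed.

HB.instance Definition _ (L : topologicalGroupType) (U K : set L)
    (Om : invariant_closed U K) :=
  isPointed.Build (points Om) (points_inhabited Om).

Section points_action.
Variables (L : topologicalGroupType) (U K : set L) (Om : invariant_closed U K).

Definition points_set (D : points Om) : set L :=
  cset (val (val D)).

Lemma points_act_subproof (x : L) (D : points Om) :
  delone_act x (val D) \in cset (val Om).
Proof.
have [_ inv] := set_mem (valP Om).
by apply/mem_set/inv; exact: (set_mem (valP D)).
Qed.

Definition points_act (x : L) (D : points Om) : points Om :=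
  exist _ (delone_act x (val D)) (points_act_subproof x D).

End points_action.

Section delone_dynamical_systems.
Variables (R : realType) (G H : topologicalGroupType) (U K : set (G * H)).
Implicit Types Om : invariant_closed U K.

Definition G_invariant Om (mu : probability (Borel (points Om)) R) : Prop :=
  forall (g : G) (A : set (points Om)), measurable (A : set (Borel (points Om))) ->
    mu (points_act (g, 1%g) @^-1` A) = mu A.

Definition uniquely_ergodic Om (mu : probability (Borel (points Om)) R) : Prop :=
  G_invariant mu /\
  forall nu : probability (Borel (points Om)) R, G_invariant nu ->
  forall A : set (points Om), measurable (A : set (Borel (points Om))) ->
    nu A = mu A.

End delone_dynamical_systems.

(** * Autocorrelation *)

Definition compactly_supported (X : topologicalType) (V : nmodType) (f : X -> V) :
  Prop := compact (closure [set x | f x != 0]).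

(* [R[i]] carries its usual topology through the alias [R[i]^o]. *)
Definition Cc (R : realType) (X : topologicalType) (f : X -> R[i]) : Prop :=
  continuous (f : X -> R[i]^o) /\ compactly_supported f.

Definition window (R : realType) (H : topologicalType) (v : H -> R) : Prop :=
  [/\ continuous v, compactly_supported v & forall x, 0 <= v x].

Section autocorrelation.
Variables (R : realType) (G H : topologicalGroupType).

Definition involution (f : G -> R[i]) : G -> R[i] := fun g => (f (g^-1)%g)^*%C.

Definition convolution (m : {measure set (Borel G) -> \bar R})
    (f1 f2 : G -> R[i]) : G -> R[i] :=
  fun g => cintegral m (fun h : Borel G => f1 h * f2 ((h : G)^-1 * g)%g).

Definition positive_definite (m gamma : {measure set (Borel G) -> \bar R}) : Prop :=
  forall f : G -> R[i], Cc f ->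
    0 <= cintegral gamma (convolution m (involution f) f).

(* The support of the sum is finite when [D] is Delone and [f] and [v] have
   compact support. *)
Definition periodization (v : H -> R) (f : G -> R[i]) (D : set (G * H)) : R[i] :=
  \sum_(x \in D) f x.1 * (v x.2)%:C%C.

(* Taking [gamma] to be a positive measure loses nothing: the identity below
   forces it to be nonnegative on the convolutions of [involution f1] and [f2]
   with [f1] and [f2] nonnegative. *)
Definition autocorrelation (m : {measure set (Borel G) -> \bar R})
    (U K : set (G * H)) (Om : invariant_closed U K) (v : H -> R)
    (mu : probability (Borel (points Om)) R)
    (gamma : {measure set (Borel G) -> \bar R}) : Prop :=
  [/\ radon gamma, positive_definite m gamma &
      forall f1 f2 : G -> R[i], Cc f1 -> Cc f2 ->
        cintegral gamma (convolution m (involution f1) f2) =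
        cintegral mu (fun D : points Om =>
          (periodization v f1 (points_set D))^*%C *
          periodization v f2 (points_set D))].

Definition weak_star_cvg (gamma_ : nat -> {measure set (Borel G) -> \bar R})
    (gamma : {measure set (Borel G) -> \bar R}) : Prop :=
  forall f : G -> R[i], Cc f ->
    (fun l => cintegral (gamma_ l) f : R[i]^o) @ \oo --> (cintegral gamma f : R[i]^o).

End autocorrelation.

(* Main.v *)
Require Import Defs.
From HB Require Import structures.
From mathcomp Require Import all_boot all_order all_algebra.
From mathcomp Require Import all_classical all_reals all_analysis.
From mathcomp Require Import complex.
From mathcomp Require Import lra measurable_realfun.
Import Order.TTheory GRing.Theory Num.Theory.
Import numFieldNormedType.Exports.
Local Open Scope classical_set_scope.
Local Open Scope ring_scope.

(** The space of Delone sets is compact and Hausdorff for the Chabauty-Fell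
    topology ([delone_compact], [delone_hausdorff]), and for [f] in Cc(G) the
    periodization is a continuous function on it ([rperiod_continuous]). The
    measures [mu_ l] live on different systems, but all of them can be tested
    against continuous functions on that one compact space. Two facts then give
    the theorem.

    1. For every continuous function [phi] on the space of Delone sets, the
    [mu_ l]-integrals of [phi] converge to its [mu]-integral ([mean_cvg]). It
    suffices to identify the limit along every ultrafilter containing the
    cofinite sets. Such a limit is a positive normalized linear functional. As
    [Om_ l] tends to [Om], the set of points of [Om_ l] at which a continuous
    function exceeds its supremum on [Om] by a fixed amount is eventually empty
    ([near_on_points_le]), so the functional depends only on the restriction of
    [phi] to [Om]. Extending functions from [Om] by Tietze, it becomes a
    functional on the continuous functions on [Om], and the Riesz representation
    theorem ([riesz_representation]) turns it into a probability measure on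
    [Om]. That measure inherits the invariance under [G] ([riesz_preimage]);
    unique ergodicity says that it is [mu].

    2. The autocorrelation of a system is known on the convolutions of
    the involution of [u] with [f], where it is the integral of the product of
    two periodizations, so that the first fact settles their convergence.
    A general [f] is the uniform limit of such convolutions with supports in one
    compact set [T], when [u] runs through an approximate identity
    ([star_conv_approx]). To pass to the limit one needs a bound on the mass of
    [T] that is uniform over all systems. It comes from one convolution of
    the involution of [b] with [b] that is bounded below on [T]
    ([star_conv_lower_bound]): its integral is the mean of the square of the
    periodization of [b], a function which is bounded on the compact space of
    Delone sets.

    Everything is first done for real functions; the complex statement follows
    by taking real and imaginary parts. *)

Set Implicit Arguments.
Unset Strict Implicit.
Unset Printing Implicit Defensive.

(** * Topological preliminaries *)

(** A property of sets that passes to subsets and finite unions and holds near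
    every point of a compact set holds for that set: otherwise the sets whose
    complement in [C] has the property form a filter without cluster point in
    [C]. It replaces the extraction of finite subcovers throughout. *)
Lemma compact_induction (T : topologicalType) (P : set T -> Prop) :
  P set0 -> (forall A B, A `<=` B -> P B -> P A) ->
  (forall A B, P A -> P B -> P (A `|` B)) ->
  forall C, compact C -> (forall x, C x -> exists2 V, nbhs x V & P V) -> P C.
Proof.
move=> P0 Pmono PU C cC Ploc; apply: contrapT => nPC.
pose F := [set S : set T | P (C `\` S)].
have FF : ProperFilter F.
  apply: Build_ProperFilter; last split.
  - by rewrite /F /= setD0.
  - by rewrite /F /= setDT.
  - by move=> A B FA FB; rewrite /F /= setDIr; exact: PU.
  - by move=> A B AB; apply: Pmono; exact: setDS.
have FC : F C by rewrite /F /= setDv.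
have [x [Cx clx]] := cC F FF FC.
have [V xV PV] := Ploc x Cx.
have FV : F (~` V) by apply: Pmono PV => y [_ /contrapT].
by have [y [nVy Vy]] := clx _ _ FV xV.
Qed.

Section real_continuity.
Variables (R : realType) (T : topologicalType).
Implicit Types f g : T -> R.

Lemma continuous_maxr f g : continuous f -> continuous g ->
  continuous (fun x => Num.max (f x) (g x)).
Proof.
move=> cf cg; under eq_fun do rewrite maxr_absE.
move=> x; apply: cvgM; last exact: cvg_cst.
apply: cvgD; first by apply: cvgD; [exact: cf|exact: cg].
by apply: cvg_norm; apply: cvgB; [exact: cf|exact: cg].
Qed.

Lemma continuous_minr f g : continuous f -> continuous g ->
  continuous (fun x => Num.min (f x) (g x)).
Proof.
move=> cf cg; under eq_fun do rewrite minr_absE.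
move=> x; apply: cvgM; last exact: cvg_cst.
apply: cvgB; first by apply: cvgD; [exact: cf|exact: cg].
by apply: cvg_norm; apply: cvgB; [exact: cf|exact: cg].
Qed.

Lemma continuous_addr f g : continuous f -> continuous g ->
  continuous (fun x => f x + g x).
Proof. by move=> cf cg x; apply: cvgD; [exact: cf|exact: cg]. Qed.

Lemma continuous_subr f g : continuous f -> continuous g ->
  continuous (fun x => f x - g x).
Proof. by move=> cf cg x; apply: cvgB; [exact: cf|exact: cg]. Qed.

Lemma continuous_mulr f g : continuous f -> continuous g ->
  continuous (fun x => f x * g x).
Proof. by move=> cf cg x; apply: cvgM; [exact: cf|exact: cg]. Qed.

Lemma continuous_cstr (c : R) : continuous (fun _ : T => c).
Proof. by move=> x; exact: cvg_cst. Qed.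

Lemma continuous_sumr n (f : nat -> T -> R) : (forall i, continuous (f i)) ->
  continuous (fun x => \sum_(i < n) f i x).
Proof.
move=> cf; elim: n => [|n IH].
  by under eq_fun do rewrite big_ord0; exact: continuous_cstr.
by under eq_fun do rewrite big_ord_recr; exact: continuous_addr.
Qed.

Lemma open_superlevel f (c : R) : continuous f -> open [set x | c < f x].
Proof.
move=> cf; have -> : [set x | c < f x] = f @^-1` [set y | c < y] by [].
by apply: open_comp => //; exact: open_gt.
Qed.

Lemma open_sublevel f (c : R) : continuous f -> open [set x | f x < c].
Proof.
move=> cf; have -> : [set x | f x < c] = f @^-1` [set y | y < c] by [].
by apply: open_comp => //; exact: open_lt.
Qed.

Lemma compact_bounded_fun f (C : set T) : continuous f -> compact C ->
  exists2 M, 0 < M & forall x, C x -> `|f x| <= M.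
Proof.
move=> cf cC.
apply: (@compact_induction _ (fun A => exists2 M, 0 < M & forall x, A x -> `|f x| <= M)) => //.
- by exists 1.
- by move=> A B AB [M M0 MB]; exists M => // x /AB; exact: MB.
- move=> A B [M M0 MA] [N N0 NB]; exists (M + N); first exact: addr_gt0.
  by move=> x [/MA|/NB] h; apply: le_trans h _; rewrite ?lerDl ?lerDr ltW.
- move=> x _; exists [set y | `|f y| < `|f x| + 1].
    apply: open_nbhs_nbhs; split.
      apply: (@open_sublevel (fun y => `|f y|)) => y.
      by apply: cvg_norm; exact: cf.
    by rewrite /= ltrDl.
  exists (`|f x| + 1); first by rewrite ltr_wpDl.
  by move=> y /ltW.
Qed.

End real_continuity.

Lemma open_Borel (X : ptopologicalType) (O : set X) :
  open O -> measurable (O : set (Borel X)).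
Proof. by move=> oO; exact: sub_sigma_algebra. Qed.

Lemma continuous_Borel (R : realType) (X : ptopologicalType) (f : X -> R) :
  continuous f -> measurable_fun setT (f : Borel X -> R).
Proof.
move=> cf; apply: (measurability _ (RGenOpens.measurableE R)).
move=> _ [_ [a [b ->]] <-]; rewrite setTI.
apply: open_Borel; apply: open_comp => //; exact: interval_open.
Qed.

Lemma continuous_integrable (R : realType) (X : ptopologicalType)
    (m : {finite_measure set (Borel X) -> \bar R}) (f : X -> R) :
  compact [set: X] -> continuous f ->
  m.-integrable setT (EFin \o (f : Borel X -> R)).
Proof.
move=> cX cf; apply: measurable_bounded_integrable => //.
- exact: fin_num_fun_lty (fin_num_measure m).
- exact: continuous_Borel.
- have [M M0 fM] := compact_bounded_fun cf cX.
  exists M; split; first exact: num_real.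
  by move=> N MN x _; apply: le_trans (fM x I) (ltW MN).
Qed.

Lemma continuous_Borel_map (X Y : ptopologicalType) (T : X -> Y) :
  continuous T -> measurable_fun setT (T : Borel X -> Borel Y).
Proof.
move=> cT; apply: (@measurability _ _ (Borel X) (Borel Y) setT T (@open Y)) => //.
by move=> _ [ O oO <-]; rewrite setTI; apply: open_Borel; apply: open_comp.
Qed.

Lemma invariant_Rintegral (R : realType) (X : ptopologicalType)
    (m : {finite_measure set (Borel X) -> \bar R}) (T : X -> X) (f : X -> R) :
  compact [set: X] -> continuous T -> continuous f ->
  (forall A : set (Borel X), measurable A -> m (T @^-1` A) = m A) ->
  \int[m]_x f (T x) = \int[m]_x f x.
Proof.
move=> cX cT cf mT; rewrite /Rintegral; congr fine.
have mmT := continuous_Borel_map cT.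
have mf : measurable_fun setT (EFin \o (f : Borel X -> R)).
  by apply/measurable_EFinP; exact: continuous_Borel.
have cfT : continuous (f \o T).
  by move=> x; apply: continuous_comp; [exact: cT|exact: cf].
transitivity (\int[pushforward m (T : Borel X -> Borel X)]_x (f x)%:E)%E.
  rewrite integral_pushforward// preimage_setT.
  exact: (@continuous_integrable _ _ _ (f \o T)).
by apply: eq_measure_integral => A mA _; exact: mT.
Qed.

(** If the preimage of a neighborhood were not in [F], an ultrafilter containing
    [F] and the complement of that preimage would contradict the hypothesis. *)
Lemma ultra_cvgP (I : Type) (T : topologicalType) (F : set_system I)
    (u : I -> T) (a : T) : Filter F ->
  (forall G, UltraFilter G -> F `<=` G -> u @ G --> a) -> u @ F --> a.
Proof.
move=> FF uG A Aa; apply: contrapT => nFA.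
pose G0 := [set S | F (S `|` u @^-1` A)].
have G0F : ProperFilter G0.
  apply: Build_ProperFilter; last split.
  - by rewrite /G0/= set0U.
  - by rewrite /G0/= setTU; exact: filterT.
  - by move=> P Q FP FQ; rewrite /G0/= setUIl; exact: filterI.
  - by move=> P Q PQ; rewrite /G0/=; apply: filterS => x [/PQ|]; [left|right].
have [G [GU G0G]] := ultraFilterLemma G0F.
have FG : F `<=` G.
  by move=> S FS; apply: G0G; apply: filterS FS => x Sx; left.
have GA : G (u @^-1` A) by exact: (uG G GU FG A Aa).
have GnA : G (~` (u @^-1` A)).
  by apply: G0G; rewrite /G0/= setUC setUv; exact: filterT.
by have [x []] := filter_ex (filterI GA GnA).
Qed.

(** The values have a cluster point by compactness of the segment, and a cluster
    point of an ultrafilter is a limit of it. *)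
Lemma ultra_bounded_cvg (R : realType) (I : Type) (F : set_system I)
    (u : I -> R) (M : R) : UltraFilter F -> (forall i, `|u i| <= M) ->
  cvg (u @ F).
Proof.
move=> FU uM.
have cI := @segment_compact R (- M) M.
have FI : (u @ F) `[- M, M]%classic.
  apply: (@filterE _ F _ (fun i => `[- M, M]%classic (u i))) => i.
  by rewrite /= in_itv/= -ler_norml.
have [p [_ clp]] := cI _ (fmap_proper_filter _ _) FI.
apply/cvg_ex; exists p => B Bp.
have [//|nB] := in_ultra_setVsetC (u @^-1` B) FU.
have : (u @ F) (~` B) by exact: nB.
by move=> /clp /(_ Bp) [x []].
Qed.

(** * The Chabauty-Fell topology and the space of Delone sets *)

Definition hit (Z : topologicalType) (O : set Z) : set (closedSet Z) :=
  [set Y | O `&` cset Y !=set0].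
Definition miss (Z : topologicalType) (C : set Z) : set (closedSet Z) :=
  [set Y | C `&` cset Y = set0].

Section fell.
Variable Z : topologicalType.

Lemma fell_open (i : set Z * set (set Z)) : fell_index i -> open (fell_base i).
Proof.
move=> Di; exists [set i]; first by move=> _ ->.
by rewrite bigcup_set1.
Qed.

Lemma open_hit (O : set Z) : open O -> open (hit O).
Proof.
move=> oO; have -> : hit O = fell_base (set0, [set O]).
  apply/seteqP; split => Y /= => [h|[_ /(_ O)]]; last exact.
  by split; [rewrite set0I|move=> _ ->].
apply: fell_open; split => /=; [exact: compact0|exact: finite_set1|].
by move=> _ ->.
Qed.

Lemma open_miss (C : set Z) : compact C -> open (miss C).
Proof.
move=> cC; have -> : miss C = fell_base (C, set0).
  by apply/seteqP; split => Y /= => [h|[]//]; split.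
by apply: fell_open; split => //=; exact: finite_set0.
Qed.

(** The hit and miss sets form a subbase, so they suffice to test convergence. *)
Lemma fell_cvg (F : set_system (closedSet Z)) {FF : Filter F} (Y : closedSet Z) :
  (forall O, open O -> hit O Y -> F (hit O)) ->
  (forall C, compact C -> miss C Y -> F (miss C)) -> F --> Y.
Proof.
move=> hO hC A; rewrite nbhsE => -[B [[D DI <-] [i Di iY]] BA].
have [ci fi oi] := DI _ Di; have [mY hY] := iY.
suff : F (fell_base i) by apply: filterS => X iX; apply: BA; exists i.
apply: filterI; first exact: hC.
have [s es] := (finite_seqP _).1 fi.
have : forall O, O \in s -> F (hit O).
  move=> O sO; have iO : i.2 O by rewrite es.
  by apply: hO; [exact: oi|exact: hY].
rewrite es; elim: s {es} => [|P s IH] Fs; first by apply: filterS filterT.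
have FP := Fs P (mem_head _ _).
have : F [set Y | forall O, [set` s] O -> O `&` cset Y !=set0].
  by apply: IH => O sO; apply: Fs; rewrite inE sO orbT.
apply: filterS2 FP => X PX sX O /=.
by rewrite inE => /orP[/eqP->//|]; exact: sX.
Qed.

Lemma cset_inj : injective (@cset Z).
Proof.
move=> [A cA] [B cB] /= AB; case: _ / AB cB => cB.
by congr ClosedSet; exact: Prop_irrelevance.
Qed.

(** The limit of an ultrafilter is the set of the points all of whose open
    neighborhoods are hit by almost every closed set; the closed sets that miss
    a neighborhood of each point of a compact set [C] miss [C] by
    [compact_induction]. *)
Lemma fell_compact : compact [set: closedSet Z].
Proof.
rewrite compact_ultra => F FU _.
pose Y := [set z : Z | forall O : set Z, open O -> O z -> F (hit O)].
have cY : closed Y.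
  move=> z clz O oO Oz.
  have [y [yY Oy]] := clz O (open_nbhs_nbhs (conj oO Oz)).
  exact: yY.
exists (ClosedSet cY); split => //; apply: fell_cvg => [ O oO [z [Oz Yz]]|C cC].
  exact: Yz.
rewrite /miss /= => CY0.
pose P (A : set Z) : Prop := F (miss A).
apply: (@compact_induction _ P _ _ _ C cC); rewrite /P.
- by apply: filterS filterT => D _; rewrite /miss/= set0I.
- move=> A B AB; apply: filterS => D; rewrite /miss /= => BD.
  by apply: subsetI_eq0 BD.
- move=> A B FA FB; apply: filterS (filterI FA FB) => D [].
  by rewrite /miss/= setIUl => -> ->; rewrite setU0.
- move=> z Cz; have : ~ Y z by move=> Yz; have : (C `&` Y) z by []; rewrite CY0.
  move=> /existsNP[ O /not_implyP[oO /not_implyP[Oz nF]]].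
  exists O; first by apply: open_nbhs_nbhs.
  have [//|] := in_ultra_setVsetC (hit O) FU.
  by apply: filterS => D /= /set0P/negP; rewrite negbK => /eqP.
Qed.

Lemma locally_compact_nbhs (z : Z) : locally_compact [set: Z] ->
  exists C, [/\ nbhs z C, compact C & closed C].
Proof.
move=> lZ; have [//|C Cz [cC kC]] := @lZ z; rewrite withinET in Cz.
by exists C.
Qed.

Lemma locally_compact_nbhs_sub (z : Z) (O : set Z) :
  hausdorff_space Z -> locally_compact [set: Z] -> nbhs z O ->
  exists C, [/\ nbhs z C, compact C, closed C & C `<=` O].
Proof.
move=> hZ lZ Oz; have [C [Cz cC kC]] := locally_compact_nbhs z lZ.
have [V Vz VO] := compact_regular hZ cC Cz (filterI Cz Oz).
exists (closure V); split.
- by apply: filterS Vz; exact: subset_closure.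
- apply: subclosed_compact cC _; first exact: closed_closure.
  by move=> x /VO[].
- exact: closed_closure.
- by move=> x /VO[].
Qed.

(** A point of [A] outside [B] has a compact neighborhood [C] that misses [B]:
    hitting the interior of [C] and missing [C] separate [A] from [B]. *)
Lemma fell_hausdorff : hausdorff_space Z -> locally_compact [set: Z] ->
  hausdorff_space (closedSet Z).
Proof.
move=> hZ lZ; rewrite open_hausdorff.
suff H (A B : closedSet Z) : ~ (cset A `<=` cset B) ->
    exists2 AB, (A \in AB.1 /\ B \in AB.2) &
                [/\ open AB.1, open AB.2 & AB.1 `&` AB.2 == set0].
  move=> A B AB.
  have [sAB|/H//] := pselect (cset A `<=` cset B).
  have /H[[P Q] /= [BP AQ] [oP oQ PQ]] : ~ (cset B `<=` cset A).
    by move=> sBA; move/eqP: AB; apply; apply: cset_inj; rewrite eqEsubset.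
  by exists (Q, P) => //; split => //=; rewrite setIC.
move=> /existsNP[z /not_implyP[Az nBz]].
have oB : open (~` cset B) by apply: closed_openC; exact: closed_cset.
have [C [Cz cC kC CB]] := locally_compact_nbhs_sub hZ lZ (open_nbhs_nbhs (conj oB nBz)).
exists (hit C°, miss C); rewrite /= ?inE; split.
- by exists z; split => //; exact: nbhs_singleton (nbhs_interior Cz).
- by apply/seteqP; split => // x [/CB].
- by apply: open_hit; exact: open_interior.
- exact: open_miss.
- rewrite -subset0 => D [[x [Cx Dx]] CD0].
  have : (C `&` cset D) x by split => //; exact: interior_subset.
  by rewrite CD0.
Qed.

End fell.

Section subtype.
Variables (X : topologicalType) (A : set X).

Lemma subtype_cvg (F : set_system A) {FF : Filter F} (x : A) :
  set_val @ F --> set_val x -> F --> x.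
Proof.
move=> cF B; rewrite nbhsE => -[C [[V oV <-] /= Vx] CB].
apply: filterS CB _; apply: cF.
by apply: open_nbhs_nbhs.
Qed.

Lemma subtype_continuous : continuous (set_val : A -> X).
Proof. exact: initial_continuous. Qed.

Lemma subtype_compact : compact A -> compact [set: A].
Proof.
move=> cA F FF _.
have FA : (set_val @ F) A.
  by apply: (@filterE _ F _ (fun x => A (set_val x))) => x; exact: set_valP.
have [p [Ap clp]] := cA _ (fmap_proper_filter _ FF) FA.
exists (exist _ p (mem_set Ap)); split => // S N FS.
rewrite nbhsE => -[C [[V oV <-] /= Vp] CN].
have : (set_val @ F) (set_val @` S).
  by apply: (@filterS _ F _ S) FS => y Sy /=; exists y.
move=> /clp /(_ (open_nbhs_nbhs (conj oV Vp))) [_ [[y Sy <-] Vy]].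
by exists y; split => //; exact: CN.
Qed.

Lemma subtype_hausdorff : hausdorff_space X -> hausdorff_space A.
Proof.
move=> hX p q clpq; apply: val_inj; apply: hX => P Q Pp Qq.
have [y [Py Qy]] := clpq _ _ (subtype_continuous Pp) (subtype_continuous Qq).
by exists (set_val y).
Qed.

Lemma subtype_closed_compact : compact [set: X] -> closed A -> compact [set: A].
Proof.
by move=> cX cA; apply: subtype_compact; apply: subclosed_compact cX _.
Qed.

End subtype.

Section group_translations.
Variable L : topologicalGroupType.

Lemma lactE (x : L) (A : set L) : lact x A = (fun y => (x^-1 * y)%g) @^-1` A.
Proof.
apply/seteqP; split=> [_ [y Ay <-]|y Ay] /=; first by rewrite mulKg.
by exists (x^-1 * y)%g => //; rewrite mulVKg.
Qed.

Lemma continuous_mulgl (x : L) : continuous (fun y : L => (x * y)%g).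
Proof. by apply: continuous_mulg => z; [exact: cvg_cst|exact: cvg_id]. Qed.

Lemma open_lact (x : L) (A : set L) : open A -> open (lact x A).
Proof.
move=> oA; rewrite lactE; apply: open_comp => // y _.
exact: continuous_mulgl.
Qed.

Lemma compact_lact (x : L) (A : set L) : compact A -> compact (lact x A).
Proof.
move=> cA; apply: continuous_compact => //; apply: continuous_subspaceT.
exact: continuous_mulgl.
Qed.

Lemma lactI (x : L) (A B : set L) :
  (A `&` lact x B !=set0) <-> (lact x^-1%g A `&` B !=set0).
Proof.
split=> [[y [Ay [b Bb bE]]]|[c [[a Aa ac] Bc]]].
  by exists b; split => //; exists y => //; rewrite -bE mulKg.
by exists a; split => //; exists c => //; rewrite -ac mulVKg.
Qed.

Lemma closedSet_act_continuous (x : L) : continuous (closedSet_act x).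
Proof.
move=> D; apply: (@fell_cvg _ _ (fmap_filter _ (nbhs_filter D))) => [ O oO|C cC].
  rewrite /hit /= => /lactI h.
  have := open_nbhs_nbhs (conj (open_hit (open_lact x^-1%g oO)) h).
  by apply: filterS => E /= /lactI.
rewrite /miss /= => CD.
have h : miss (lact x^-1%g C) D.
  apply: contrapT => /eqP/set0P/lactI; rewrite CD => -[? []//].
have := open_nbhs_nbhs (conj (open_miss (compact_lact (x := x^-1%g) cC)) h).
apply: filterS => E /= h'.
by apply: contrapT => /eqP/set0P/lactI; rewrite h' => -[? []//].
Qed.

End group_translations.

Section delone_space.
Variables (L : topologicalGroupType) (U K : set L).
Hypotheses (hL : hausdorff_space L) (lL : locally_compact [set: L]).
Hypotheses (oU : open U) (cK : compact K).

(** Both Delone conditions are closed. If the limit had no point in the compact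
    set of the [z * k^-1] with [k] in [K], then neither would sets close to it,
    and [z] would not be covered by them. Two distinct points of the limit in one
    translate of [U] would be approximated by two distinct points of sets close
    to it, in the same translate since [U] is open. *)
Lemma delone_lim (F : set_system (closedSet L)) (Y : closedSet L) :
  ProperFilter F -> F (@delone L U K) -> F --> Y -> delone U K Y.
Proof.
move=> FF FD FY.
have cov z : exists2 x, cset Y x & exists2 k, K k & (x * k)%g = z.
  pose C := [set (z * k^-1)%g | k in K].
  have cC : compact C.
    apply: continuous_compact => //; apply: continuous_subspaceT => k.
    apply: continuous_comp; first exact: invg_continuous.
    exact: continuous_mulgl.
  have [[_ [[k Kk <-] Yx]]|nCY] := pselect (C `&` cset Y !=set0).
    by exists (z * k^-1)%g => //; exists k => //; rewrite -mulgA mulVg mulg1.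
  have mY : miss C Y by apply/eqP; apply: contraT => /set0P.
  have FC : F (miss C).
    by apply: FY; apply: open_nbhs_nbhs; split => //; exact: open_miss.
  have [D [[_ _ cD] mD]] := filter_ex (filterI FD FC).
  have : [set: L] z by [].
  rewrite -cD => -[d Dd [k Kk dk]].
  have : (C `&` cset D) d by split => //; exists k => //; rewrite -dk mulgK.
  by rewrite mD.
split.
- by have [x Yx _] := cov 1%g; exists x.
- move=> x a b [Ua Ya] [Ub Yb]; apply/eqP; apply: contraT => ab.
  move: (hL); rewrite open_hausdorff => /(_ _ _ ab)[[A B]/=].
  rewrite !inE => -[Aa Bb] [oA oB AB].
  have oxU := open_lact x oU.
  have FA : F (hit (A `&` lact x U)).
    apply: FY; apply: open_nbhs_nbhs; split; last by exists a.
    by apply: open_hit; exact: openI.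
  have FB : F (hit (B `&` lact x U)).
    apply: FY; apply: open_nbhs_nbhs; split; last by exists b.
    by apply: open_hit; exact: openI.
  have [D [[_ sep _] [[a' [[Aa' xa'] Da']] [b' [[Bb' xb'] Db']]]]] :=
    filter_ex (filterI FD (filterI FA FB)).
  have ab' : a' = b' by apply: (sep x).
  have : (A `&` B) a' by split => //; rewrite ab'.
  by rewrite AB.
- rewrite -subTset => z _; have [x Yx [k Kk xk]] := cov z.
  by exists x => //; exists k.
Qed.

Lemma delone_compact : compact [set: delone U K].
Proof.
apply: subtype_compact; rewrite compact_ultra => F FU FD.
have := @fell_compact L; rewrite compact_ultra => /(_ F FU (filterT)) [Y [_ FY]].
by exists Y; split => //; exact: delone_lim FY.
Qed.

Lemma delone_hausdorff : hausdorff_space (delone U K).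
Proof. by apply: subtype_hausdorff; exact: fell_hausdorff. Qed.

Lemma delone_act_continuous (x : L) : continuous (@delone_act L U K x).
Proof.
move=> D; apply: (@subtype_cvg _ _ _ (fmap_filter _ (nbhs_filter D))).
apply: (@continuous_comp _ _ _ set_val (closedSet_act x)).
  exact: subtype_continuous.
exact: closedSet_act_continuous.
Qed.

Variable Om : invariant_closed U K.

Lemma points_compact : compact [set: points Om].
Proof.
by apply: subtype_closed_compact; [exact: delone_compact|exact: closed_cset].
Qed.

Lemma points_hausdorff : hausdorff_space (points Om).
Proof. by apply: subtype_hausdorff; exact: delone_hausdorff. Qed.

Lemma points_act_continuous (x : L) : continuous (@points_act L U K Om x).
Proof.
move=> D; apply: (@subtype_cvg _ _ _ (fmap_filter _ (nbhs_filter D))).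
apply: (@continuous_comp _ _ _ set_val (@delone_act L U K x)).
  exact: subtype_continuous.
exact: delone_act_continuous.
Qed.

End delone_space.

(** * The Riesz representation theorem on a compact Hausdorff space *)

Section riesz.
Variables (R : realType) (X : ptopologicalType).
Hypotheses (hX : hausdorff_space X) (cX : compact [set: X]).
Variable L : (X -> R) -> R.
Hypothesis LD : forall f g : X -> R, continuous f -> continuous g ->
  L (fun x => f x + g x) = L f + L g.
Hypothesis LM : forall (c : R) (f : X -> R), continuous f -> L (fun x => c * f x) = c * L f.
Hypothesis L_le : forall f g : X -> R, continuous f -> continuous g ->
  (forall x, f x <= g x) -> L f <= L g.
Hypothesis L1 : L (fun=> 1) = 1.

Let Lcst (c : R) : L (fun=> c) = c.
Proof.
rewrite -[RHS]mulr1 -L1 -LM; last exact: continuous_cstr.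
by congr L; apply/funext => x; rewrite mulr1.
Qed.

Let L_ge0 (f : X -> R) : continuous f -> (forall x, 0 <= f x) -> 0 <= L f.
Proof.
by move=> cf f0; rewrite -(Lcst 0); apply: L_le => //; exact: continuous_cstr.
Qed.

Let L_sum n (f : nat -> X -> R) : (forall i, continuous (f i)) ->
  L (fun x => \sum_(i < n) f i x) = \sum_(i < n) L (f i).
Proof.
move=> cf; elim: n => [|n IH].
  under eq_fun do rewrite big_ord0.
  by rewrite big_ord0 Lcst.
under eq_fun do rewrite big_ord_recr.
by rewrite LD ?IH ?big_ord_recr//=; exact: continuous_sumr.
Qed.

Definition below (O : set X) : set (X -> R) :=
  [set f : X -> R | [/\ continuous f, forall x, 0 <= f x <= 1 & forall x, f x != 0 -> O x]].

(** The measure of an open set, following Riesz. *)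
Definition riesz_content (O : set X) : \bar R :=
  ereal_sup [set (L f)%:E | f in below O].

(** The measure that represents [L], as an outer measure on all subsets. *)
Definition riesz (A : set (Borel X)) : \bar R :=
  ereal_inf [set riesz_content O | O in [set O : set X | open O /\ A `<=` O]].

Lemma below_bump (O : set X) x : open O -> O x ->
  exists2 f, below O f & \forall y \near x, f y = 1.
Proof.
move=> oO Ox.
have nX := compact_normal hX cX.
have [] := @urysohn_ext_itv X R nX (~` O) [set x] 0 2.
- exact: open_closedC.
- exact: accessible_closed_set1 (hausdorff_accessible hX) _.
- by apply/disjoints_subset => y nOy /= yx; apply: nOy; rewrite yx.
- by [].
move=> f [cf f0 f2 rf].
have cg : continuous (fun y => Num.min (f y) 1).
  by apply: continuous_minr => //; exact: continuous_cstr.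
exists (fun y => Num.min (f y) 1).
  split => // y.
    have : range f (f y) by exists y.
    by move/rf; rewrite /= in_itv/= => /andP[a b]; rewrite le_min a ler01 ge_min lexx orbT.
  apply: contra_neqP => nOy; have -> : f y = 0 by apply: f0; exists y.
  by rewrite min_l.
have fx : f x = 2 by apply: f2; exists x.
apply: (@filterS _ _ _ [set y | 1 < f y]).
  by move=> y /= /ltW fy; rewrite min_r.
apply: open_nbhs_nbhs; split; first exact: open_superlevel.
by rewrite /= fx ltr1n.
Qed.

Lemma below_L f O : below O f -> 0 <= L f <= 1.
Proof.
move=> [cf f01 _]; rewrite L_ge0//=; last by move=> x; case/andP: (f01 x).
by rewrite -L1; apply: L_le => // [|x]; [exact: continuous_cstr|case/andP: (f01 x)].
Qed.

Lemma below0 O : below O (fun=> 0).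
Proof.
by split => [|x|x]; [exact: continuous_cstr|rewrite lexx ler01|rewrite eqxx].
Qed.

Lemma riesz_content_ge O f : below O f -> ((L f)%:E <= riesz_content O)%E.
Proof. by move=> Of; apply: ereal_sup_ubound; exists f. Qed.

Lemma riesz_content_ge0 O : (0 <= riesz_content O)%E.
Proof. by apply: le_trans (riesz_content_ge (below0 O)); rewrite Lcst. Qed.

Lemma riesz_content_le1 O : (riesz_content O <= 1)%E.
Proof.
by apply: ge_ereal_sup => _ [f Of <-]; rewrite lee_fin; case/andP: (below_L Of).
Qed.

Lemma le_riesz_content O P : O `<=` P -> (riesz_content O <= riesz_content P)%E.
Proof.
move=> OP; apply: ge_ereal_sup => _ [f [cf f01 fO] <-].
by apply: riesz_content_ge; split => // x /fO /OP.
Qed.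

Lemma riesz_open O : open O -> riesz O = riesz_content O.
Proof.
move=> oO; apply/eqP; rewrite eq_le; apply/andP; split.
  by apply: ereal_inf_lbound; exists O => //; split.
by apply: le_ereal_inf_tmp => _ [P [oP OP] <-]; exact: le_riesz_content.
Qed.

Lemma riesz_ge0 A : (0 <= riesz A)%E.
Proof. by apply: le_ereal_inf_tmp => _ [ O _ <-]; exact: riesz_content_ge0. Qed.

Lemma le_riesz : {homo riesz : A B / A `<=` B >-> (A <= B)%E}.
Proof.
move=> A B AB; apply: le_ereal_inf_tmp => _ [ O [oO BO] <-].
by apply: ereal_inf_lbound; exists O => //; split => //; exact: subset_trans BO.
Qed.

Lemma riesz0 : riesz set0 = 0%E.
Proof.
rewrite riesz_open; last exact: open0.
apply/eqP; rewrite eq_le riesz_content_ge0 andbT.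
apply: ge_ereal_sup => _ [f [cf f01 f0] <-].
have -> : f = fun=> 0 by apply/funext => x; apply/eqP; apply: contraT => /f0.
by rewrite Lcst.
Qed.

Lemma riesz_setT : riesz setT = 1%E.
Proof.
rewrite riesz_open; last exact: openT.
apply/eqP; rewrite eq_le riesz_content_le1/= -[X in (X <= _)%E]/((1%R)%:E) -L1.
apply: riesz_content_ge; split => //; first exact: continuous_cstr.
by move=> x; rewrite ler01 lexx.
Qed.

(** Near a point where [f] is at least [e], a bump below one of the [O n] equals
    1 and hence bounds [f]; finitely many bumps below the same [O n] are merged
    by taking their maximum. The functions [phi n] are the merged bumps. *)
Lemma below_bigcup (O : nat -> set X) f (e : R) : (forall n, open (O n)) ->
  0 < e -> below (\bigcup_n O n) f ->
  exists (phi : nat -> X -> R) (N : nat), (forall n, below (O n) (phi n)) /\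
    forall x, f x <= e + \sum_(n < N) phi n x.
Proof.
move=> oO e0 [cf f01 fO].
pose P (A : set X) : Prop := exists (phi : nat -> X -> R) (N : nat),
  (forall n, below (O n) (phi n)) /\ forall x, A x -> f x <= e + \sum_(n < N) phi n x.
suff [phi [N [b h]]] : P setT by exists phi, N; split => // x; exact: h.
apply: compact_induction cX _ => [|A B AB [phi [N [b h]]]|A B|x _].
- by exists (fun _ _ => 0), 0%N; split => // n; exact: below0.
- by exists phi, N; split => // x /AB; exact: h.
- move=> [phi [N [b h]]] [psi [M [b' h']]].
  exists (fun n x => Num.max (phi n x) (psi n x)), (maxn N M).
  have mono (chi : nat -> X -> R) K : (forall n, below (O n) (chi n)) ->
    (forall n x, chi n x <= Num.max (phi n x) (psi n x)) -> (K <= maxn N M)%N ->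
    forall x, e + \sum_(n < K) chi n x <=
      e + \sum_(n < maxn N M) Num.max (phi n x) (psi n x).
    move=> bc hc KNM x; rewrite lerD2l.
    rewrite -(big_mkord xpredT (fun n => chi n x)).
    rewrite -(big_mkord xpredT (fun n => Num.max (phi n x) (psi n x))).
    rewrite [leRHS](big_cat_nat (leq0n K) KNM)/=; apply: ler_wpDr.
      apply: sumr_ge0 => n _; apply: le_trans (hc n x).
      by have [_ /(_ x)/andP[]] := bc n.
    by apply: ler_sum => n _; exact: hc.
  split => [n|x [Ax|Bx]].
  + have [c1 i1 s1] := b n; have [c2 i2 s2] := b' n.
    split => [|x|x]; first exact: continuous_maxr.
      have /andP[a1 a2] := i1 x; have /andP[a3 a4] := i2 x.
      by rewrite le_max a1/= ge_max a2.
    have [h1|h1] := eqVneq (phi n x) 0; last by move=> _; exact: s1.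
    have [h2|h2] := eqVneq (psi n x) 0; last by move=> _; exact: s2.
    by rewrite h1 h2 maxxx eqxx.
  + apply: le_trans (h x Ax) _; apply: mono => // [n y|]; last exact: leq_maxl.
    by rewrite le_max lexx.
  + apply: le_trans (h' x Bx) _; apply: mono => // [n y|]; last exact: leq_maxr.
    by rewrite le_max lexx orbT.
- have [fxe|efx] := ltP (f x) e.
    exists [set y | f y < e].
      by apply: open_nbhs_nbhs; split => //; exact: open_sublevel.
    exists (fun _ _ => 0), 0%N; split=> [n|y /= /ltW fy]; first exact: below0.
    by rewrite big_ord0 addr0.
  have [n _ Onx] : (\bigcup_n O n) x by apply: fO; rewrite gt_eqF// (lt_le_trans e0).
  have [g bg g1] := below_bump (oO n) Onx.
  exists [set y | g y = 1] => //.
  exists (fun k => if k == n then g else fun=> 0), n.+1; split=> [k|y /= gy].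
    by case: eqP => [->//|_]; exact: below0.
  rewrite big_ord_recr/= eqxx gy big1 ?add0r; last first.
    by move=> i _; rewrite ltn_eqF.
  have /andP[_ fy] := f01 y.
  by apply: le_trans fy _; rewrite lerDr ltW.
Qed.

Lemma riesz_content_bigcup (O : nat -> set X) : (forall n, open (O n)) ->
  (riesz_content (\bigcup_n O n) <= \sum_(n <oo) riesz_content (O n))%E.
Proof.
move=> oO; apply: ge_ereal_sup => _ [f Of <-].
apply/lee_addgt0Pr => e e0.
have [phi [N [b h]]] := below_bigcup oO e0 Of.
have cphi n : continuous (phi n) by case: (b n).
have : L f <= e + \sum_(n < N) L (phi n).
  rewrite -L_sum// -{1}(Lcst e) -LD; last 2 first.
  - exact: continuous_cstr.
  - exact: continuous_sumr.
  apply: L_le => //; first by case: Of.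
  by apply: continuous_addr; [exact: continuous_cstr|exact: continuous_sumr].
rewrite -lee_fin EFinD => /le_trans; apply; rewrite addeC leeD2r//.
rewrite -sumEFin.
apply: (@le_trans _ _ (\sum_(n < N) riesz_content (O n))%E).
  by apply: lee_sum => n _; exact: riesz_content_ge.
rewrite -(big_mkord xpredT (fun n => riesz_content (O n))).
by apply: nneseries_lim_ge => n _ _; exact: riesz_content_ge0.
Qed.

Lemma riesz_approx A (e : R) : 0 < e ->
  exists O, [/\ open O, A `<=` O & (riesz_content O <= riesz A + e%:E)%E].
Proof.
move=> e0.
have fr : riesz A \is a fin_num.
  rewrite ge0_fin_numE; last exact: riesz_ge0.
  apply: (@le_lt_trans _ _ 1%E); last by rewrite ltry.
  by rewrite -riesz_setT; exact: le_riesz.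
have [_ [ O [oO AO] <-] h] := lb_ereal_inf_adherent e0 fr.
by exists O; split => //; exact: ltW.
Qed.

Lemma riesz_sigma_subadditive : sigma_subadditive riesz.
Proof.
move=> A; apply/lee_addgt0Pr => e e0.
apply: le_trans (epsilon_trick _ _ (ltW e0)) => [|n]; last exact: riesz_ge0.
have /choice[ O hO] : forall n, exists O, [/\ open O, A n `<=` O &
    (riesz_content O <= riesz (A n) + (e / (2 ^ n.+1)%:R)%:E)%E].
  by move=> n; apply: riesz_approx; rewrite divr_gt0// ltr0n expn_gt0.
apply: (@le_trans _ _ (riesz_content (\bigcup_n O n))).
  apply: ereal_inf_lbound; exists (\bigcup_n O n) => //; split.
    by apply: bigcup_open => n _; case: (hO n).
  by apply: subset_bigcup => n _; case: (hO n).
apply: le_trans (riesz_content_bigcup _) _; first by move=> n; case: (hO n).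
apply: lee_nneseries => [n _ _|n _]; first exact: riesz_content_ge0.
by case: (hO n).
Qed.

HB.instance Definition _ := isOuterMeasure.Build R (Borel X) riesz
  riesz0 riesz_ge0 le_riesz riesz_sigma_subadditive.

(** An almost optimal [f] for [V `&` O] vanishes off [O], so [V `&` ~` O] lies in
    the open set [W] where [f < e]. Cutting [f] down by [e] makes it vanish on
    [W], so that it can be added to any function below [W] while staying below
    [V]. *)
Lemma riesz_caratheodory O : open O -> caratheodory_measurable riesz O.
Proof.
move=> oO; apply: le_caratheodory_measurable => A.
apply: le_ereal_inf_tmp => _ [V [oV AV] <-].
apply: (@le_trans _ _ (riesz (V `&` O) + riesz (V `&` ~` O))%E).
  by apply: leeD; apply: le_riesz; exact: setSI.
rewrite riesz_open; last exact: openI.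
have fr : riesz (V `&` ~` O) \is a fin_num.
  rewrite ge0_fin_numE; last exact: riesz_ge0.
  apply: (@le_lt_trans _ _ 1%E); last by rewrite ltry.
  by rewrite -riesz_setT; exact: le_riesz.
rewrite -leeBrDr//; apply: ge_ereal_sup => _ [f bf <-].
rewrite leeBrDr//; apply/lee_addgt0Pr => e e0.
have [cf f01 fVO] := bf.
pose W := V `&` [set x | f x < e].
have oW : open W by apply: openI => //; exact: open_sublevel.
have VW : V `&` ~` O `<=` W.
  move=> x [Vx nOx]; split => //=.
  by have [->//|/fVO[_ //]] := eqVneq (f x) 0.
have := le_riesz VW; rewrite (riesz_open oW) => /(leeD2l (L f)%:E)/le_trans; apply.
rewrite -leeBrDl//; apply: ge_ereal_sup => _ [g [cg g01 gW] <-].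
rewrite leeBrDl// -EFinD.
(* Where [g] is nonzero, [f < e] and the first summand is 0. *)
pose h x := Num.max (f x - e) 0 + g x.
have cm : continuous (fun x => Num.max (f x - e) 0).
  apply: continuous_maxr; last exact: continuous_cstr.
  by apply: continuous_subr => //; exact: continuous_cstr.
have ch : continuous h by apply: continuous_addr.
have bh : below V h.
  split => // x.
    rewrite /h; have /andP[f0 f1] := f01 x; have /andP[g0 g1] := g01 x.
    have [fe|ef] := ltP (f x) e.
      by rewrite max_r ?add0r ?g0// subr_le0 ltW.
    have -> : g x = 0.
      by apply/eqP; apply: contraT => /gW[_ /=]; rewrite ltNge ef.
    rewrite addr0 max_l ?subr_ge0// ef/=.
    by apply: le_trans f1; rewrite gerBl ltW.
  rewrite /h; have [->|/gW[]//] := eqVneq (g x) 0.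
  have [f0|/fVO[]//] := eqVneq (f x) 0.
  by rewrite f0 sub0r addr0 max_r ?eqxx// oppr_le0 ltW.
apply: le_trans (leeD2r _ (riesz_content_ge bh)).
rewrite -EFinD lee_fin /h LD// addrAC lerD2r.
rewrite -{2}(Lcst e) -LD//; last exact: continuous_cstr.
apply: L_le => // [|x].
  by apply: continuous_addr => //; exact: continuous_cstr.
by rewrite -lerBlDr le_max lexx.
Qed.

Lemma riesz_Borel (A : set (Borel X)) :
  measurable A -> caratheodory_measurable riesz A.
Proof.
apply: smallest_sub => [|O]; last exact: riesz_caratheodory.
split.
- exact: caratheodory_measurable_set0.
- by move=> B mB; rewrite setTD; exact: caratheodory_measurable_setC.
- by move=> F mF; exact: caratheodory_measurable_bigcup.
Qed.

Lemma riesz_sigma_additive : semi_sigma_additive riesz.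
Proof.
move=> F mF tF mUF; apply: (@caratheodory_measure_sigma_additive R (Borel X)).
- by move=> i; exact: riesz_Borel.
- exact: tF.
- exact: riesz_Borel.
Qed.

HB.instance Definition _ := isMeasure.Build _ (Borel X) R riesz
  riesz0 riesz_ge0 riesz_sigma_additive.

HB.instance Definition _ := Measure_isProbability.Build _ (Borel X) R riesz
  riesz_setT.

Definition riesz_probability : probability (Borel X) R := riesz.

Local Notation "\I f" := (\int[riesz_probability]_x f x) (at level 10).

Let rint (f : X -> R) : continuous f ->
  riesz_probability.-integrable setT (EFin \o (f : Borel X -> R)).
Proof. exact: continuous_integrable. Qed.

(** The measure of the open set where [f] is positive lies between [L f] and the
    integral of [g]. *)
Lemma L_le_integral1 (f g : X -> R) : continuous f -> continuous g ->
  (forall x, 0 <= f x <= 1) -> (forall x, 0 <= g x) ->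
  (forall x, 0 < f x -> 1 <= g x) -> L f <= \I g.
Proof.
move=> cf cg f01 g0 fg.
pose O := [set x | 0 < f x].
have oO : open O by exact: open_superlevel.
have mO := open_Borel oO.
have : ((L f)%:E <= riesz O)%E.
  rewrite riesz_open//; apply: riesz_content_ge; split => // x fx0.
  by rewrite /O /= lt_def fx0; case/andP: (f01 x).
have -> : riesz O = (\int[riesz_probability]_x (\1_O x)%:E)%E.
  by rewrite integral_indic// setIT.
rewrite -lee_fin => /le_trans; apply.
rewrite /Rintegral fineK; last exact: integrable_fin_num (rint cg).
apply: ge0_le_integral => //.
- by apply/measurable_EFinP; exact: measurable_indic.
- by apply/measurable_EFinP; exact: continuous_Borel.
- move=> x _; rewrite lee_fin indicE; case: (boolP (x \in O)) => [|_]; last exact: g0.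
  by rewrite inE => /fg.
Qed.

(** After multiplication by a large [N], slice the function into layers [b k] of
    height 1. By [L_le_integral1] the functional [L] at one layer is at most the
    integral of the layer below, as the latter equals 1 where the former is
    positive. Only the lowest layer is left over; it costs at most 1, that is
    [N^-1] before the multiplication. *)
Lemma L_le_integral (f : X -> R) : continuous f -> (forall x, 0 <= f x <= 1) ->
  L f <= \I f.
Proof.
move=> cf f01; apply/ler_addgt0Pr => e e0.
(* Slicing into [N] layers loses at most [N^-1 <= e]. *)
pose N := (Num.trunc e^-1).+1.
have N0 : 0 < N%:R :> R by rewrite ltr0n.
have Ne : N%:R^-1 <= e.
  by rewrite invf_ple ?posrE// ltW// truncnS_gt.
pose F x := N%:R * f x.
have cF : continuous F by apply: continuous_mulr => //; exact: continuous_cstr.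
pose G k x := Num.min (F x) k%:R.
have cG k : continuous (G k) by apply: continuous_minr => //; exact: continuous_cstr.
pose b k x := G k.+1 x - G k x.
have cb k : continuous (b k) by exact: continuous_subr.
have bI k : L (b k.+1) <= \I (b k).
  apply: L_le_integral1 => // x; rewrite /b /G -!natr1.
  - by case: (ltP (F x) (k%:R + 1 + 1)) => ?;
      case: (ltP (F x) (k%:R + 1)) => ?; apply/andP; split; lra.
  - by case: (ltP (F x) (k%:R + 1)) => ?; case: (ltP (F x) k%:R) => ?; lra.
  - by case: (ltP (F x) (k%:R + 1 + 1)) => ?;
      case: (ltP (F x) (k%:R + 1)) => ?; case: (ltP (F x) k%:R) => ?; lra.
have GI k : L (G k.+1) <= 1 + \I (G k).
  elim: k => [|k IH].
    apply: (@le_trans _ _ 1).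
      rewrite -L1; apply: L_le => // [|x]; first exact: continuous_cstr.
      by rewrite /G ge_min lexx orbT.
    rewrite lerDl; apply: Rintegral_ge0 => x _.
    by rewrite /G le_min lexx mulr_ge0//; case/andP: (f01 x).
  have -> : G k.+2 = fun x => G k.+1 x + b k.+1 x.
    by apply/funext => x; rewrite /b addrC subrK.
  have -> : \I (G k.+1) = \I (G k) + \I (b k).
    rewrite -RintegralD//; [|exact: rint|exact: rint].
    by apply: eq_Rintegral => x _; rewrite /b addrC subrK.
  by rewrite LD// addrA; exact: lerD.
have := GI N.
have FN x : F x <= N%:R.
  by rewrite /F ler_piMr// ?ler0n//; case/andP: (f01 x).
have -> : G N.+1 = F.
  apply/funext => x; rewrite /G min_l//; apply: le_trans (FN x) _.
  by rewrite ler_nat.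
have -> : G N = F by apply/funext => x; rewrite /G min_l.
rewrite LM// RintegralZl//; last exact: rint.
rewrite -ler_pdivlMl// mulrDr mulr1 mulrA mulVf ?gt_eqF// mul1r => /le_trans; apply.
by rewrite addrC lerD2l.
Qed.

(** The inequality [L_le_integral], applied to [f] and to [1 - f], gives equality
    for [f] with values between 0 and 1; the general case follows by an affine
    change of [f]. *)
Lemma riesz_representation (f : X -> R) : continuous f -> L f = \I f.
Proof.
have step (g : X -> R) : continuous g -> (forall x, 0 <= g x <= 1) -> L g = \I g.
  move=> cg g01; apply/eqP; rewrite eq_le L_le_integral//=.
  have c1 : continuous (fun x => 1 - g x).
    by apply: continuous_subr => //; exact: continuous_cstr.
  have : L (fun x => 1 - g x) <= \I (fun x => 1 - g x).
    by apply: L_le_integral => // x; have /andP[a a'] := g01 x; lra.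
  rewrite RintegralB//; [|by apply: rint; exact: continuous_cstr|exact: rint].
  rewrite Rintegral_cst// mul1r [X in fine X]riesz_setT/=.
  have -> : L (fun x => 1 - g x) = 1 - L g.
    apply/eqP; rewrite -subr_eq opprK -LD// -{2}L1; apply/eqP.
    by congr L; apply/funext => x; rewrite subrK.
  by rewrite lerD2l lerN2.
move=> cf; have [M M0 fM] := compact_bounded_fun cf cX.
(* The affine map that sends [-M] to 0 and [M] to 1. *)
pose g x := (2 * M)^-1 * f x + 2^-1.
have cMf : continuous (fun x => (2 * M)^-1 * f x).
  by apply: continuous_mulr => //; exact: continuous_cstr.
have cg : continuous g.
  by apply: continuous_addr => //; exact: continuous_cstr.
have M2 : 0 < 2 * M by rewrite mulr_gt0.
have : L g = \I g.
  apply: step => // x; rewrite /g.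
  have := fM x I; rewrite ler_norml => /andP[a a'].
  have -> : (2 * M)^-1 * f x + 2^-1 = (f x + M) / (2 * M).
    rewrite [RHS]mulrDl [_ * f x]mulrC; congr (_ + _).
    by rewrite invfM mulrC -mulrA mulVf ?mulr1// gt_eqF.
  by rewrite ler_pdivlMr// ler_pdivrMr//; apply/andP; split; lra.
rewrite LD//; last exact: continuous_cstr.
rewrite RintegralD//; [|exact: rint|by apply: rint; exact: continuous_cstr].
rewrite Rintegral_cst// Lcst [X in fine X]riesz_setT mulr1 => /addIr.
rewrite LM// RintegralZl//; last exact: rint.
by apply: mulfI; rewrite invr_neq0// gt_eqF.
Qed.

(** Composition with the right inverse [S] of [T] maps the functions below the
    preimage of [O] under [T] to functions below [O] without changing [L]. *)
Lemma riesz_preimage_le (T S : X -> X) :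
  continuous T -> continuous S -> cancel S T ->
  (forall f : X -> R, continuous f -> L (f \o S) = L f) ->
  forall A : set X, (riesz (T @^-1` A) <= riesz A)%E.
Proof.
move=> cT cS ST LS A; apply: le_ereal_inf_tmp => _ [ O [oO AO] <-].
have oTO : open (T @^-1` O) by apply: open_comp.
apply: (@le_trans _ _ (riesz_content (T @^-1` O))).
  rewrite -(riesz_open oTO); apply: le_riesz; exact: preimage_subset.
apply: ge_ereal_sup => _ [f [cf f01 fO] <-].
have cfS : continuous (f \o S) by move=> x; apply: continuous_comp; [exact: cS|exact: cf].
rewrite -LS//; apply: riesz_content_ge; split => //= x.
by move=> /fO; rewrite /preimage/= ST.
Qed.

Lemma riesz_preimage (T S : X -> X) : continuous T -> continuous S ->
  cancel S T -> cancel T S ->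
  (forall f : X -> R, continuous f -> L (f \o T) = L f) ->
  forall A : set X, riesz (T @^-1` A) = riesz A.
Proof.
move=> cT cS ST TS LT A.
have LS (f : X -> R) : continuous f -> L (f \o S) = L f.
  move=> cf; rewrite -LT; last first.
    by move=> x; apply: continuous_comp; [exact: cS|exact: cf].
  by congr L; apply/funext => x /=; rewrite TS.
apply/eqP; rewrite eq_le (riesz_preimage_le cT cS ST LS)/=.
have := riesz_preimage_le cS cT TS LT (T @^-1` A).
have -> // : S @^-1` (T @^-1` A) = A.
by apply/seteqP; split => x /=; rewrite /preimage/= ST.
Qed.

End riesz.

(** * Unique ergodicity and convergence of means *)

Section unique_ergodicity.
Variables (R : realType) (G H : topologicalGroupType) (U K : set (G * H)).
Hypotheses (hL : hausdorff_space (G * H)%type)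
  (lL : locally_compact [set: (G * H)%type]) (oU : open U) (cK : compact K).
Local Notation X := (delone U K).
Let cX : compact [set: X] := @delone_compact _ U K hL oU cK.
Let hX : hausdorff_space X := @delone_hausdorff _ U K hL lL.
Let cP (Om : invariant_closed U K) : compact [set: points Om] :=
  points_compact hL oU cK (Om := Om).

Let emb (Om : invariant_closed U K) (D : points Om) : X := set_val D.

Let emb_continuous Om : continuous (@emb Om).
Proof. exact: subtype_continuous. Qed.

Definition on_points (phi : X -> R) (Om : invariant_closed U K) (D : points Om) : R :=
  phi (emb D).

Lemma on_points_continuous (phi : X -> R) Om :
  continuous phi -> continuous (on_points phi (Om := Om)).
Proof.
by move=> cphi D; apply: continuous_comp; [exact: emb_continuous|exact: cphi].
Qed.

Lemma points_extension (Om : invariant_closed U K) (f : points Om -> R) :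
  continuous f ->
  exists e : X -> R, continuous e /\ forall D, on_points e D = f D.
Proof.
move=> cf; have [M M0 fM] := compact_bounded_fun cf (@cP Om).
have clA : closed (cset (val Om)) by exact: closed_cset.
(* Only the values of [f'] on [Om] matter; 0 elsewhere is a default value. *)
pose f' (D : X) : R := if pselect (D \in cset (val Om)) is left h
                       then f (exist _ D h) else 0.
have f'E (D : points Om) : f' (emb D) = f D.
  rewrite /f'; case: pselect => [h|]; last by case; exact: valP.
  by congr f; apply: val_inj.
have [] := @continuous_bounded_extension X R (compact_normal hX cX) _ clA f' M M0.
- apply/subspace_sigL_continuousP.
  have -> // : sigL (cset (val Om)) f' = f by apply/funext => D; exact: f'E.
- move=> D OD; have /= -> := f'E (exist _ D (mem_set OD)); exact: fM.
- move=> e [ef ce _]; exists e; split => // D.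
  by rewrite /on_points -ef ?f'E//; exact: valP.
Qed.

Variables (Om : invariant_closed U K) (Om_ : nat -> invariant_closed U K).
Hypothesis cvgOm : Om_ @ \oo --> Om.

(** The Delone sets at which [psi + e <= phi] form a compact set disjoint from
    [Om], hence disjoint from [Om_ l] for large [l]. *)
Lemma near_on_points_le (phi psi : X -> R) (e : R) :
  continuous phi -> continuous psi -> 0 < e ->
  (forall D : points Om, on_points phi D <= on_points psi D) ->
  \forall l \near \oo, forall D : points (Om_ l),
    on_points phi D <= on_points psi D + e.
Proof.
move=> cphi cpsi e0 le.
pose C := [set D : X | psi D + e <= phi D].
have kC : closed C.
  have -> : C = ~` [set D | phi D - psi D < e].
    apply/seteqP; split => D; rewrite /C/=.
      by rewrite ltrBlDr addrC => h; apply/negP; rewrite -leNgt.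
    by move=> /negP; rewrite -leNgt lerBrDr addrC.
  by apply: open_closedC; apply: open_sublevel; exact: continuous_subr.
have cC : compact C by exact: subclosed_compact kC cX _.
have mC : miss C (val Om).
  apply/seteqP; split => // D [CD OD].
  have := le (exist _ D (mem_set OD)); rewrite /on_points/=.
  move=> /(le_trans CD); rewrite gerDl leNgt e0//.
have : (val \o Om_) @ \oo --> val Om.
  by apply: (cvg_comp _ _ cvgOm); exact: subtype_continuous.
move=> /(_ _ (open_nbhs_nbhs (conj (open_miss cC) mC))) h.
apply: (@filterS _ \oo _ (fun l => miss C (val (Om_ l)))) h => l ml D; rewrite leNgt; apply/negP => h.
have : (C `&` cset (val (Om_ l))) (emb D).
  by split; [exact: ltW|exact: set_valP].
by rewrite ml.
Qed.

Variable mu_ : forall l, probability (Borel (points (Om_ l))) R.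
Hypothesis inv_ : forall l, G_invariant (mu_ l).

Definition mean (phi : X -> R) (l : nat) : R := \int[mu_ l]_D on_points phi D.

Let rint (phi : X -> R) l : continuous phi ->
  (mu_ l).-integrable setT (EFin \o (@on_points phi (Om_ l) : Borel _ -> R)).
Proof.
move=> cphi; apply: continuous_integrable; first exact: cP.
exact: on_points_continuous.
Qed.

Lemma mean_cst (c : R) l : mean (fun=> c) l = c.
Proof.
rewrite /mean (eq_Rintegral _ (g := fun=> c))//.
by rewrite Rintegral_cst// [X in fine X]probability_setT mulr1.
Qed.

Lemma meanD (phi psi : X -> R) l : continuous phi -> continuous psi ->
  mean (fun D => phi D + psi D) l = mean phi l + mean psi l.
Proof. by move=> c1 c2; rewrite /mean -RintegralD//; exact: rint. Qed.

Lemma meanZ (c : R) (phi : X -> R) l : continuous phi ->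
  mean (fun D => c * phi D) l = c * mean phi l.
Proof. by move=> cphi; rewrite /mean -RintegralZl//; exact: rint. Qed.

Lemma mean_le (phi psi : X -> R) l : continuous phi -> continuous psi ->
  (forall D : points (Om_ l), on_points phi D <= on_points psi D) ->
  mean phi l <= mean psi l.
Proof.
move=> c1 c2 le; by apply: le_Rintegral => //; exact: rint.
Qed.

Lemma mean_act (phi : X -> R) (g : G) l : continuous phi ->
  mean (phi \o delone_act (g, 1%g)) l = mean phi l.
Proof.
move=> cphi; apply: (@invariant_Rintegral R (points (Om_ l)) (mu_ l)
  (points_act (g, 1%g)) (on_points phi (Om := Om_ l))).
- exact: cP.
- exact: points_act_continuous.
- exact: on_points_continuous.
- by move=> A mA; exact: inv_.
Qed.

Lemma mean_bounded (phi : X -> R) : continuous phi ->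
  exists M, forall l, `|mean phi l| <= M.
Proof.
move=> cphi; have [M M0 phiM] := compact_bounded_fun cphi cX.
exists M => l; rewrite ler_norml; apply/andP; split.
  rewrite -[leLHS](mean_cst (- M) l); apply: mean_le => //; first exact: continuous_cstr.
  by move=> D; have := phiM (emb D) I; rewrite ler_norml => /andP[].
rewrite -[leRHS](mean_cst M l); apply: mean_le => //; first exact: continuous_cstr.
by move=> D; have := phiM (emb D) I; rewrite ler_norml => /andP[].
Qed.

Section ultralimit.
Variable F : set_system nat.
Hypotheses (FU : UltraFilter F) (ooF : \oo `<=` F).

Let limF (phi : X -> R) : R := lim (mean phi @ F).

Let limF_cvg (phi : X -> R) : continuous phi -> mean phi @ F --> limF phi.
Proof.
move=> /mean_bounded[M hM]; exact: ultra_bounded_cvg hM.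
Qed.

Let limFE (phi : X -> R) (a : R) : mean phi @ F --> a -> limF phi = a.
Proof. by move=> h; apply: cvg_lim h; exact: Rhausdorff. Qed.

Let limF_le (phi psi : X -> R) : continuous phi -> continuous psi ->
  (forall D : points Om, on_points phi D <= on_points psi D) ->
  limF phi <= limF psi.
Proof.
move=> c1 c2 le; apply/ler_addgt0Pr => e e0.
have ce : continuous (fun D => psi D + e).
  by apply: continuous_addr => //; exact: continuous_cstr.
have h : mean (fun D => psi D + e) @ F --> limF psi + e.
  rewrite (_ : mean (fun D => psi D + e) = fun l => mean psi l + e); last first.
    by apply/funext => l; rewrite meanD ?mean_cst//; exact: continuous_cstr.
  by apply: cvgD; [exact: limF_cvg|exact: cvg_cst].
apply: ler_cvg_to (limF_cvg c1) h _; apply: ooF.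
by apply: filterS (near_on_points_le c1 c2 e0 le) => l hl; exact: mean_le.
Qed.

Let limF_eq (phi psi : X -> R) : continuous phi -> continuous psi ->
  (forall D : points Om, on_points phi D = on_points psi D) -> limF phi = limF psi.
Proof.
move=> c1 c2 e; apply/eqP; rewrite eq_le; apply/andP.
by split; apply: limF_le => // D; rewrite e.
Qed.

Let ext (f : points Om -> R) : X -> R :=
  get [set e : X -> R | continuous e /\ forall D, on_points e D = f D].

Let ext_continuous f : continuous f -> continuous (ext f).
Proof. by move=> /points_extension /getPex[]. Qed.

Let extE f : continuous f -> forall D, on_points (ext f) D = f D.
Proof. by move=> /points_extension /getPex[]. Qed.

Let L (f : points Om -> R) : R := limF (ext f).

Let LD (f g : points Om -> R) : continuous f -> continuous g ->
  L (fun x => f x + g x) = L f + L g.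
Proof.
move=> cf cg; have cfg := continuous_addr cf cg.
have ce := continuous_addr (ext_continuous cf) (ext_continuous cg).
rewrite /L (@limF_eq _ (fun D => ext f D + ext g D))//; last 2 first.
- exact: ext_continuous.
- move=> D; rewrite extE// -(extE cf) -(extE cg)//.
apply: limFE; rewrite (_ : mean _ = fun l => mean (ext f) l + mean (ext g) l).
  by apply: cvgD; apply: limF_cvg; exact: ext_continuous.
by apply/funext => l; rewrite meanD//; exact: ext_continuous.
Qed.

Let LM (c : R) (f : points Om -> R) : continuous f ->
  L (fun x => c * f x) = c * L f.
Proof.
move=> cf; have ccf := continuous_mulr (@continuous_cstr _ _ c) cf.
have ce := continuous_mulr (@continuous_cstr _ _ c) (ext_continuous cf).
rewrite /L (@limF_eq _ (fun D => c * ext f D))//; last 2 first.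
- exact: ext_continuous.
- move=> D; rewrite extE// -(extE cf)//.
apply: limFE; rewrite (_ : mean _ = fun l => c * mean (ext f) l).
  by apply: cvgM; [exact: cvg_cst|apply: limF_cvg; exact: ext_continuous].
by apply/funext => l; rewrite meanZ//; exact: ext_continuous.
Qed.

Let L_le (f g : points Om -> R) : continuous f -> continuous g ->
  (forall x, f x <= g x) -> L f <= L g.
Proof.
move=> cf cg fg; apply: limF_le; [exact: ext_continuous..|].
by move=> D; rewrite !extE.
Qed.

Let L1 : L (fun=> 1) = 1.
Proof.
have c1 : continuous (fun _ : points Om => 1 : R) by exact: continuous_cstr.
rewrite /L (@limF_eq _ (fun=> 1)); last 3 first.
- exact: ext_continuous.
- exact: continuous_cstr.
- by move=> D; rewrite extE.
apply: limFE; rewrite (_ : mean _ = fun=> 1); first exact: cvg_cst.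
by apply/funext => l; rewrite mean_cst.
Qed.

Let L_act (g : G) (f : points Om -> R) : continuous f ->
  L (f \o points_act (g, 1%g)) = L f.
Proof.
move=> cf.
have cfa : continuous (f \o points_act (g, 1%g)).
  by move=> D; apply: continuous_comp; [exact: points_act_continuous|exact: cf].
have ce : continuous (ext f \o delone_act (g, 1%g)).
  move=> D; apply: continuous_comp; first exact: delone_act_continuous.
  exact: ext_continuous.
rewrite /L (@limF_eq _ (ext f \o delone_act (g, 1%g)))//; last 2 first.
- exact: ext_continuous.
- by move=> D; rewrite extE//= -(extE cf).
apply: limFE; rewrite (_ : mean _ = mean (ext f)).
  by apply: limF_cvg; exact: ext_continuous.
by apply/funext => l; rewrite mean_act//; exact: ext_continuous.
Qed.

Let nu : probability (Borel (points Om)) R :=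
  riesz_probability (points_hausdorff hL lL (Om := Om)) (@cP Om) LD LM L_le L1.

Let points_actK (g : G) :
  cancel (@points_act _ _ _ Om (g^-1%g, 1%g)) (points_act (g, 1%g)).
Proof.
move=> D; apply: val_inj; apply: val_inj; apply: cset_inj => /=.
rewrite !lactE; apply/funext => y /=; rewrite /preimage/= mulgA.
have -> : ((g^-1, 1)^-1 * (g, 1)^-1 = (1 : G * H))%g.
  by congr pair; rewrite /= ?invgK ?mulgV// invg1 mulg1.
by rewrite mul1g.
Qed.

Let nu_invariant : G_invariant nu.
Proof.
move=> g A mA; apply: (@riesz_preimage R (points Om) L
  (points_act (g, 1%g)) (points_act (g^-1%g, 1%g))).
- exact: points_act_continuous.
- exact: points_act_continuous.
- exact: points_actK.
- by have := @points_actK g^-1%g; rewrite invgK.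
- by move=> f; exact: L_act.
Qed.

(** The limit functional is represented by an invariant probability on [Om],
    which is [mu] by unique ergodicity. *)
Lemma ultralimit_mean (mu : probability (Borel (points Om)) R) (phi : X -> R) :
  uniquely_ergodic mu -> continuous phi ->
  mean phi @ F --> \int[mu]_D on_points phi D.
Proof.
move=> [_ ue] cphi; have cr := on_points_continuous (Om := Om) cphi.
have -> : \int[mu]_D on_points phi D = \int[nu]_D on_points phi D.
  rewrite /Rintegral; congr fine; apply: eq_measure_integral => A mA _.
  by apply/esym; apply: (ue nu) => //; exact: nu_invariant.
rewrite -riesz_representation// /L.
rewrite (@limF_eq _ phi)//; [exact: limF_cvg|exact: ext_continuous|].
by move=> D; rewrite extE.
Qed.

End ultralimit.

Lemma mean_cvg (mu : probability (Borel (points Om)) R) (phi : X -> R) :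
  uniquely_ergodic mu -> continuous phi ->
  mean phi @ \oo --> \int[mu]_D on_points phi D.
Proof.
move=> ue cphi; apply: ultra_cvgP => F FU ooF.
exact: ultralimit_mean.
Qed.

End unique_ergodicity.

(** * Continuity of sums over Delone sets *)

Section bumps.
Variables (R : realType) (Z : topologicalType).
Hypotheses (hZ : hausdorff_space Z) (lZ : locally_compact [set: Z]).

Lemma compactly_supported_sub (V : nmodType) (f : Z -> V) (C : set Z) : compact C -> closed C ->
  (forall x, f x != 0 -> C x) -> compactly_supported f.
Proof.
move=> cC kC fC; apply: subclosed_compact cC _; first exact: closed_closure.
by apply: subset_trans (closureS _) _; [exact: fC|rewrite -(closure_id _).1].
Qed.

Lemma bump_point (O : set Z) (x : Z) : open O -> O x ->
  exists h : Z -> R, [/\ continuous h, compactly_supported h,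
    (forall y, 0 <= h y), (forall y, h y != 0 -> O y) & h x = 1].
Proof.
move=> oO Ox.
have [C [Cx cC kC CO]] := locally_compact_nbhs_sub hZ lZ (open_nbhs_nbhs (conj oO Ox)).
have crZ := @locally_compact_completely_regular Z R lZ hZ.
have kB : closed (~` C°) by apply: open_closedC; exact: open_interior.
have nBx : ~ (~` C°) x by move=> h; apply: h; exact: nbhs_singleton (nbhs_interior Cx).
have /(@uniform_separatorP _ R)[f [cf f01 fx fB]] := crZ x _ kB nBx.
have fC y : 1 - f y != 0 -> C y.
  move=> fy; apply: contrapT => nCy; move/eqP: fy; apply.
  have -> : f y = 1 by apply: fB; exists y => // /interior_subset.
  by rewrite subrr.
exists (fun y => 1 - f y); split.
- by apply: continuous_subr => //; exact: continuous_cstr.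
- exact: compactly_supported_sub cC kC fC.
- move=> y; have : range f (f y) by exists y.
  by move=> /f01; rewrite /= in_itv/= subr_ge0 => /andP[].
- by move=> y /fC /CO.
- have -> : f x = 0 by apply: fx; exists x.
  by rewrite subr0.
Qed.

Lemma compactly_supportedD (f g : Z -> R) : compactly_supported f ->
  compactly_supported g -> compactly_supported (fun x => f x + g x).
Proof.
move=> cf cg; apply: (compactly_supported_sub (compactU cf cg)).
  by apply: closedU; exact: closed_closure.
move=> x; have [fx|fx _] := eqVneq (f x) 0; last by left; exact: subset_closure.
by rewrite fx add0r => gx; right; exact: subset_closure.
Qed.

Lemma compactly_supportedM (f g : Z -> R) : compactly_supported f ->
  compactly_supported (fun x => g x * f x).
Proof.
move=> cf; apply: (compactly_supported_sub cf); first exact: closed_closure.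
by move=> x; rewrite mulf_eq0 negb_or => /andP[_ fx]; exact: subset_closure.
Qed.

Lemma compactly_supported0 : compactly_supported (fun _ : Z => 0 : R).
Proof.
apply: (compactly_supported_sub compact0); first exact: closed0.
by move=> x; rewrite eqxx.
Qed.

Lemma bump_compact (C : set Z) : compact C ->
  exists h : Z -> R, [/\ continuous h, compactly_supported h,
    (forall y, 0 <= h y) & forall y, C y -> 1 <= h y].
Proof.
pose P (A : set Z) : Prop := exists h : Z -> R, [/\ continuous h,
  compactly_supported h, (forall y, 0 <= h y) & forall y, A y -> 1 <= h y].
move=> cC; apply: (@compact_induction _ P _ _ _ C cC).
- exists (fun=> 0); split => //; first exact: continuous_cstr.
  exact: compactly_supported0.
- by move=> A B AB [h [ch sh h0 h1]]; exists h; split => // y /AB; exact: h1.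
- move=> A B [h [ch sh h0 h1]] [g [cg sg g0 g1]].
  exists (fun x => h x + g x); split.
  + exact: continuous_addr.
  + exact: compactly_supportedD.
  + by move=> y; exact: addr_ge0.
  + by move=> y [/h1|/g1] h2; rewrite (le_trans h2)// ?lerDl ?lerDr.
- move=> x _; have [h [ch sh h0 _ hx]] := bump_point openT (I : setT x).
  exists [set y | 2^-1 < h y].
    apply: open_nbhs_nbhs; split; first exact: open_superlevel.
    by rewrite /= hx invf_lt1// ltr1n.
  exists (fun y => 2 * h y); split.
  + by apply: continuous_mulr => //; exact: continuous_cstr.
  + exact: compactly_supportedM.
  + by move=> y; rewrite mulr_ge0.
  + by move=> y /= /ltW; rewrite -ler_pdivrMl// mulr1.
Qed.

(** Off the closed support of [F] the quotient is locally 0, whatever the zeros of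
    [h]. *)
Lemma continuous_divr_supp (F h : Z -> R) : continuous F -> continuous h ->
  (forall x, closure [set y | F y != 0] x -> 0 < h x) ->
  continuous (fun x => F x / h x).
Proof.
move=> cF ch Fh x; have [h0|/eqP hx] := pselect (h x = 0).
  have nc : ~ closure [set y | F y != 0] x.
    by move=> /Fh; rewrite h0 ltxx.
  have nz : \forall y \near x, F y = 0.
    have : nbhs x (~` closure [set y | F y != 0]).
      apply: open_nbhs_nbhs; split => //; apply: closed_openC; exact: closed_closure.
    apply: filterS => y ncy; apply: contrapT => /eqP Fy; apply: ncy.
    exact: subset_closure.
  apply: (@near_cst_continuous Z R 0).
  by apply: filterS nz => y ->; rewrite mul0r.
by apply: cvgM; [exact: cF|apply: cvgV => //; exact: ch].
Qed.

End bumps.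

Section delone_sums.
Variables (R : realType) (L : topologicalGroupType) (U K : set L).
Hypotheses (hL : hausdorff_space L) (lL : locally_compact [set: L]).
Hypotheses (oU : open U) (U1 : U 1%g).
Local Notation X := (delone U K).

Definition psum (F : L -> R) (D : X) : R := \sum_(x \in cset (val D)) F x.

(** The weights [h] that make sums over Delone sets continuous. They are closed
    under addition, and bumps supported in a translate of [U] are among them;
    this localizes sums without a partition of unity. *)
Definition delone_summable (h : L -> R) : Prop :=
  (forall D : X, finite_set (cset (val D) `&` [set x | h x != 0])) /\
  forall F : L -> R, continuous F -> continuous (psum (fun x => F x * h x)).

Lemma psum_supp (F : L -> R) (D : X) (A : set L) :
  (forall x, F x != 0 -> A x) ->
  psum F D = \sum_(x \in cset (val D) `&` A) F x.
Proof.
move=> FA; apply/esym/fsbig_widen => [x []//|x [Dx nDA] /=]; apply: contrapT => /eqP Fx.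
by apply: nDA; split => //; exact: FA.
Qed.

Lemma delone_summableD (g h : L -> R) : (forall x, 0 <= g x) -> (forall x, 0 <= h x) ->
  delone_summable g -> delone_summable h -> delone_summable (fun x => g x + h x).
Proof.
move=> g0 h0 [fg sg] [fh sh]; split => [D|F cF].
  apply: (@sub_finite_set _ _ ((cset (val D) `&` [set x | g x != 0]) `|`
    (cset (val D) `&` [set x | h x != 0]))); last by rewrite finite_setU; split.
  move=> x [Dx /=]; have [->|gx] := eqVneq (g x) 0; last by left.
  by rewrite add0r; right.
rewrite (_ : psum _ = fun D => psum (fun x => F x * g x) D + psum (fun x => F x * h x) D).
  by apply: continuous_addr; [exact: sg|exact: sh].
apply/funext => D; pose A := [set x | g x != 0] `|` [set x | h x != 0].
rewrite !(@psum_supp _ D A); last 3 first.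
- by move=> x; rewrite mulf_eq0 negb_or => /andP[_ hx]; right.
- by move=> x; rewrite mulf_eq0 negb_or => /andP[_ gx]; left.
- move=> x; rewrite mulf_eq0 negb_or => /andP[_].
  by have [->|gx _] := eqVneq (g x) 0; [rewrite add0r; right|left].
rewrite -fsbig_split/=; first by apply: eq_fsbigr => x _; rewrite mulrDr.
by rewrite /A setIUr finite_setU; split; [exact: fg|exact: fh].
Qed.

Lemma delone_isolated (D : X) (x : L) : is_subset1 (lact x U `&` cset (val D)).
Proof. by have [_ sep _] := set_valP D; exact: sep. Qed.

Lemma psum_local (E : L -> R) (y : L) (D : X) (d : L) :
  (forall x, E x != 0 -> lact y U x) -> cset (val D) d -> E d != 0 ->
  psum E D = E d.
Proof.
move=> EU Dd Ed; rewrite (psum_supp D EU).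
have -> : cset (val D) `&` lact y U = [set d].
  apply/seteqP; split => [x [Dx Ux]|_ ->]; last by split => //; exact: EU.
  by apply: (@delone_isolated D y); split => //; exact: EU.
by rewrite fsbig_set1.
Qed.

Lemma psum_local_le (E : L -> R) (y : L) (D : X) (e : R) : 0 < e ->
  (forall x, E x != 0 -> lact y U x) ->
  (forall x, cset (val D) x -> `|E x| < e) -> `|psum E D| < e.
Proof.
move=> e0 EU Ee.
have [[d [Dd Ed]]|no] := pselect (exists d, cset (val D) d /\ E d != 0).
  by rewrite (psum_local EU Dd Ed); exact: Ee.
rewrite /psum fsbig1 ?normr0// => x Dx; apply: contrapT => /eqP Ex.
by apply: no; exists x.
Qed.

(** At most one point of a Delone set lies in the translate of [U] by [y], so the
    sum is the value of [E] at that point or 0. A set close to [D] has such a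
    point close to that of [D]; if [D] has none, it misses the compact set where
    [e <= `|E x|]. *)
Lemma psum_local_continuous (E : L -> R) (y : L) : continuous E ->
  compactly_supported E -> (forall x, E x != 0 -> lact y U x) ->
  continuous (psum E).
Proof.
move=> cE sE EU D.
apply/(cvgrPdist_lt (FF := nbhs_filter D)) => e e0.
have vc := @subtype_continuous _ (@delone L U K).
have [[d [Dd Ed]]|no] := pselect (exists d, cset (val D) d /\ E d != 0).
  pose O := [set x | `|E d - E x| < e] `&` [set x | 0 < `|E x|].
  have oO : open O.
    apply: openI.
      apply: (@open_sublevel _ _ (fun x => `|E d - E x|)) => x.
      by apply: cvg_norm; apply: cvgB; [exact: cvg_cst|exact: cE].
    apply: (@open_superlevel _ _ (fun x => `|E x|)) => x.
    by apply: cvg_norm; exact: cE.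
  have hD : hit O (val D) by exists d; rewrite /O/= subrr normr0 normr_gt0.
  have := vc D _ (open_nbhs_nbhs (conj (open_hit oO) hD)) => h.
  apply: (@filterS _ _ (nbhs_filter D) (fun D' => hit O (val D'))) h => D' [d' [[/= dd' Ed'] Dd']].
  rewrite (psum_local EU Dd Ed) (psum_local EU Dd')// -?normr_gt0//.
pose C := [set x | e <= `|E x|].
have cC : compact C.
  apply: subclosed_compact sE _.
    have -> : C = ~` [set x | `|E x| < e].
      by apply/seteqP; split => x /=; rewrite /C/= leNgt => /negP.
    apply: open_closedC; apply: (@open_sublevel _ _ (fun x => `|E x|)) => x.
    by apply: cvg_norm; exact: cE.
  move=> x; rewrite /C/= => ex; apply: subset_closure => /=.
  by rewrite -normr_gt0; exact: lt_le_trans ex.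
have ED0 x : cset (val D) x -> E x = 0.
  by move=> Dx; apply: contrapT => /eqP Ex; apply: no; exists x.
have mD : miss C (val D).
  apply/seteqP; split => // x [+ Dx]; rewrite /C/= ED0// normr0 leNgt.
  by rewrite e0.
have -> : psum E D = 0 by rewrite /psum fsbig1.
have := vc D _ (open_nbhs_nbhs (conj (open_miss cC) mD)) => h.
apply: (@filterS _ _ (nbhs_filter D) (fun D' => miss C (val D'))) h => D' mD'; rewrite sub0r normrN.
apply: psum_local_le e0 EU _ => x Dx; rewrite ltNge; apply/negP => ex.
have : (C `&` cset (val D')) x by [].
by rewrite mD'.
Qed.

Lemma delone_summable_local (h : L -> R) (y : L) : continuous h ->
  compactly_supported h -> (forall x, h x != 0 -> lact y U x) -> delone_summable h.
Proof.
move=> ch sh hU; split => [D|F cF].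
  have [[d [Dd hd]]|no] := pselect (exists d, cset (val D) d /\ h d != 0).
    apply: (sub_finite_set _ (finite_set1 d)) => x [Dx /hU xU].
    by apply: (@delone_isolated D y); split => //; exact: hU.
  rewrite (_ : _ `&` _ = set0)//; apply/seteqP; split => // x [Dx hx].
  by apply: no; exists x.
apply: (@psum_local_continuous _ y).
- exact: continuous_mulr.
- exact: compactly_supportedM.
- by move=> x; rewrite mulf_eq0 negb_or => /andP[_ /hU].
Qed.

(** By compactness some [h] as in [delone_summable] is positive on the support of
    [F]; write [F] as [(F / h) * h]. *)
Lemma psum_continuous (F : L -> R) : continuous F -> compactly_supported F ->
  continuous (psum F).
Proof.
move=> cF sF.
pose P (A : set L) : Prop := exists h : L -> R, [/\ continuous h,
  (forall y, 0 <= h y), (forall y, A y -> 0 < h y) & delone_summable h].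
have [h [ch h0 hA [_ sh]]] : P (closure [set x | F x != 0]).
  apply: (@compact_induction _ P _ _ _ _ sF).
  - exists (fun=> 0); split => //; first exact: continuous_cstr.
    split => [D|E cE].
      by rewrite (_ : _ `&` _ = set0)//; apply/seteqP; split => x // [_ /=]; rewrite eqxx.
    rewrite (_ : psum _ = fun=> 0); first exact: continuous_cstr.
    by apply/funext => D; rewrite /psum fsbig1// => x _; rewrite mulr0.
  - by move=> A B AB [h [ch h0 h1 sh]]; exists h; split => // y /AB; exact: h1.
  - move=> A B [h [ch h0 h1 sh]] [g [cg g0 g1 sg]].
    exists (fun x => h x + g x); split.
    + exact: continuous_addr.
    + by move=> y; exact: addr_ge0.
    + by move=> y [/h1|/g1] h2; [rewrite ltr_pwDl|rewrite ltr_wpDl].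
    + exact: delone_summableD.
  - move=> x _.
    have xUx : lact x U x by exists 1%g => //; rewrite mulg1.
    have [h [ch sh h0 hU hx]] := bump_point R hL lL (open_lact x oU) xUx.
    exists [set y | 0 < h y].
      by apply: open_nbhs_nbhs; split; [exact: open_superlevel|rewrite /= hx].
    by exists h; split => //; exact: delone_summable_local hU.
have FE : F = fun x => F x / h x * h x.
  apply/funext => x; have [->|Fx] := eqVneq (F x) 0; first by rewrite !mul0r.
  by rewrite divfK// gt_eqF//; apply: hA; exact: subset_closure.
rewrite FE; apply: sh; exact: continuous_divr_supp.
Qed.

End delone_sums.

(** * Haar measure and convolutions *)

Lemma uniform_near (R : realType) (A B : topologicalType) (Phi : A * B -> R)
    (T : set A) (b0 : B) (e : R) : continuous Phi -> compact T -> 0 < e ->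
  \forall b \near b0, forall a, T a -> `|Phi (a, b) - Phi (a, b0)| < e.
Proof.
move=> cPhi cT e0.
pose P (S : set A) : Prop :=
  \forall b \near b0, forall a, S a -> `|Phi (a, b) - Phi (a, b0)| < e.
apply: (@compact_induction _ P _ _ _ _ cT) => [|S S' SS'|S S' PS PS'|a _].
- by rewrite /P; apply: filterE => b a [].
- by rewrite /P; apply: filterS => b h a /SS'; exact: h.
- by move: PS PS'; rewrite /P; apply: filterS2 => b h h' a [/h|/h'].
have e2 : 0 < e / 2 by rewrite divr_gt0.
have /cvgrPdist_lt /(_ _ e2) := cPhi (a, b0).
move=> [[N M] /= [Na Mb] NM].
have Mb0 := nbhs_singleton Mb.
exists N => //; rewrite /P; apply: filterS Mb => b Mb' a' Na'.
have h1 : `|Phi (a, b0) - Phi (a', b)| < e / 2 by apply: (NM (a', b)).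
have h2 : `|Phi (a, b0) - Phi (a', b0)| < e / 2.
  by apply: (NM (a', b0)); split => //=; exact: Mb0.
by apply: (@distm_lt_split _ _ (Phi (a, b0))); rewrite // distrC.
Qed.

Section haar.
Variables (R : realType) (G : topologicalGroupType).
Hypotheses (hG : hausdorff_space G) (lG : locally_compact [set: G]).

Lemma Cc_integrable (m : {measure set (Borel G) -> \bar R}) (f : G -> R) :
  (forall C : set G, compact C -> (m C < +oo)%E) ->
  continuous f -> compactly_supported f ->
  m.-integrable setT (EFin \o (f : Borel G -> R)).
Proof.
move=> mfin cf sf.
pose A := closure [set x | f x != 0].
have mA : measurable (A : set (Borel G)).
  rewrite -[A]setCK; apply: measurableC; apply: open_Borel.
  by apply: closed_openC; exact: closed_closure.
have := @measurable_bounded_integrable _ (Borel G) R m f A mA (mfin A sf).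
have mf := continuous_Borel cf.
move=> /(_ (measurable_funTS mf)).
have [M M0 fM] := compact_bounded_fun cf sf.
have bf : [bounded f x | x in A].
  exists M; split; first exact: num_real.
  by move=> N MN x Ax; apply: le_trans (fM x Ax) (ltW MN).
move=> /(_ bf); rewrite integrable_mkcond//.
congr (integrable _ _ _); apply/funext => x; rewrite patchE.
case: ifPn => //; rewrite notin_setE => nAx /=; congr EFin.
by apply/esym/eqP; apply: contraT => fx; case: nAx; exact: subset_closure.
Qed.

Variable m : {measure set (Borel G) -> \bar R}.
Hypothesis hm : left_haar m.

Lemma haar_fin (C : set G) : compact C -> (m C < +oo)%E.
Proof. by have [[h _ _] _ _] := hm; exact: h. Qed.

(** If a nonempty open set were null, then so would be its translates, every
    compact set and, by inner regularity, the whole group. *)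
Lemma haar_open_gt0 (O : set G) (o : G) : open O -> O o -> (0 < m O)%E.
Proof.
move=> oO Oo; rewrite lt_def measure_ge0 andbT; apply/negP => /eqP mO0.
have [[_ _ inner] /negP mG0 inv] := hm; apply: mG0; apply/eqP.
rewrite inner; last exact: openT.
apply/eqP; rewrite eq_le; apply/andP; split; last first.
  by apply: ereal_sup_ubound; exists set0; [split => //; exact: compact0|rewrite measure0].
apply: ge_ereal_sup => _ [C [cC _] <-].
pose P (A : set G) := exists B : set (Borel G), [/\ measurable B, A `<=` B & m B = 0%E].
have [B [mB CB mB0]] : P C.
  apply: (@compact_induction _ P _ _ _ _ cC) => [|A A' AA' [B [mB AB B0]]|A A' [B [mB AB B0]] [B' [mB' AB' B0']]|x _].
  - by exists set0; split => //; rewrite measure0.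
  - by exists B; split => //; exact: subset_trans AB.
  - exists (B `|` B'); split; [exact: measurableU|exact: setUSS|].
    by rewrite measureU0.
  pose g := (x * o^-1)%g.
  have oV : open (lact g O) by exact: open_lact.
  exists (lact g O).
    by apply: open_nbhs_nbhs; split => //; exists o => //; rewrite /g -mulgA mulVg mulg1.
  exists (lact g O); split => //; first exact: open_Borel.
  by rewrite lactE inv//; exact: open_Borel.
rewrite -mB0; apply: le_measure => //; rewrite inE.
  rewrite -[C]setCK; apply: measurableC; apply: open_Borel.
  by apply: closed_openC; exact: compact_closed.
exact: mB.
Qed.

Lemma continuous_invg_comp (f : G -> R) : continuous f ->
  continuous (fun x => f (x^-1)%g).
Proof.
move=> cf x; apply: (@continuous_comp _ _ _ (fun x : G => (x^-1)%g) f).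
  exact: invg_continuous.
exact: cf.
Qed.

Lemma compactly_supported_invg (f : G -> R) : compactly_supported f ->
  compactly_supported (fun x => f (x^-1)%g).
Proof.
move=> sf.
have cC : compact [set (x^-1)%g | x in closure [set x | f x != 0]].
  apply: continuous_compact => //; apply: continuous_subspaceT.
  exact: invg_continuous.
apply: (compactly_supported_sub cC); first exact: compact_closed.
by move=> x fx; exists (x^-1)%g; [exact: subset_closure|rewrite invgK].
Qed.

Lemma haar_integral_gt0 (f : G -> R) (x : G) : continuous f ->
  compactly_supported f -> (forall y, 0 <= f y) -> 0 < f x ->
  0 < \int[m]_y f y.
Proof.
move=> cf sf f0 fx.
pose c := f x / 2.
have c0 : 0 < c by rewrite divr_gt0.
pose O := [set y | c < f y].
have oO : open O by exact: open_superlevel.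
have Ox : O x by rewrite /O/= /c ltr_pdivrMr// ltr_pMr// ltr1n.
have fi := Cc_integrable haar_fin cf sf.
have mO := open_Borel oO.
have h : (c%:E * m O <= \int[m]_y (f y)%:E)%E.
  rewrite -(setIT O) -(integral_indic m measurableT mO).
  rewrite -ge0_integralZl//; last 2 first.
  - by apply/measurable_EFinP; exact: measurable_indic.
  - by rewrite lee_fin ltW.
  apply: ge0_le_integral => //.
  - by move=> y _; rewrite mule_ge0// lee_fin ltW.
  - apply: measurable_funeM; apply/measurable_EFinP; exact: measurable_indic.
  - by apply/measurable_EFinP; exact: continuous_Borel.
  - move=> y _; rewrite -EFinM lee_fin indicE; case: (boolP (y \in O)) => [|_].
      by rewrite inE mulr1 => /ltW.
    by rewrite mulr0.
rewrite /Rintegral -lte_fin fineK; last exact: integrable_fin_num.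
apply: lt_le_trans h; apply: mule_gt0; first by rewrite lte_fin.
exact: haar_open_gt0 Ox.
Qed.

(** The convolution of the involution of [f1] with [f2], for real functions. *)
Definition star_conv (f1 f2 : G -> R) (g : G) : R :=
  \int[m]_h (f1 ((h : G)^-1)%g * f2 ((h : G)^-1 * g)%g).

Section star_conv.
Variables (f1 f2 : G -> R).
Hypotheses (c1 : continuous f1) (s1 : compactly_supported f1).
Hypotheses (c2 : continuous f2) (s2 : compactly_supported f2).

Lemma star_conv_integrand_continuous g :
  continuous (fun h : G => f1 (h^-1)%g * f2 (h^-1 * g)%g).
Proof.
apply: continuous_mulr; first exact: continuous_invg_comp.
move=> h; apply: (@continuous_comp _ _ _ (fun h : G => (h^-1 * g)%g) f2).
  by apply: continuous_mulg => z; [exact: invg_continuous|exact: cvg_cst].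
exact: c2.
Qed.

Lemma star_conv_integrand_supported g :
  compactly_supported (fun h : G => f1 (h^-1)%g * f2 (h^-1 * g)%g).
Proof.
under eq_fun do rewrite mulrC.
by apply: compactly_supportedM; exact: compactly_supported_invg.
Qed.

Lemma star_conv_integrable g : m.-integrable setT
  (EFin \o (fun h : Borel G => f1 ((h : G)^-1)%g * f2 ((h : G)^-1 * g)%g)).
Proof.
apply: Cc_integrable; first exact: haar_fin.
  exact: star_conv_integrand_continuous.
exact: star_conv_integrand_supported.
Qed.

Lemma star_conv_ge0 g : (forall x, 0 <= f1 x) -> (forall x, 0 <= f2 x) ->
  0 <= star_conv f1 f2 g.
Proof. by move=> f10 f20; apply: Rintegral_ge0 => h _; rewrite mulr_ge0. Qed.

Lemma star_conv_supp (A B : set G) g : (forall x, f1 x != 0 -> A x) ->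
  (forall x, f2 x != 0 -> B x) -> star_conv f1 f2 g != 0 ->
  [set (x.1^-1 * x.2)%g | x in A `*` B] g.
Proof.
move=> f1A f2B; apply: contraNP => nAB.
rewrite /star_conv (eq_Rintegral _ (g := fun=> 0)).
  by rewrite Rintegral_cst// mul0r.
move=> h _; apply: contrapT => /eqP; rewrite mulf_eq0 negb_or => /andP[h1 h2].
apply: nAB; exists ((h : G)^-1%g, ((h : G)^-1 * g)%g).
  by split; [exact: f1A|exact: f2B].
by rewrite /= mulKg.
Qed.

Lemma compact_inv_mul (A B : set G) : compact A -> compact B ->
  compact [set (x.1^-1 * x.2)%g | x in A `*` B].
Proof.
move=> cA cB; apply: continuous_compact; last exact: compact_setX.
apply: continuous_subspaceT; apply: continuous_mulg.
  move=> x; apply: (@continuous_comp _ _ _ fst (fun y : G => (y^-1)%g)).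
    exact: cvg_fst.
  exact: invg_continuous.
by move=> x; exact: cvg_snd.
Qed.

Lemma star_conv_supported : compactly_supported (star_conv f1 f2).
Proof.
have cC := compact_inv_mul s1 s2.
apply: (compactly_supported_sub cC); first exact: compact_closed.
by move=> g; apply: star_conv_supp => x fx; exact: subset_closure.
Qed.

(** By [uniform_near], translates of [f2] are uniformly close to each other on
    the compact set that carries the first factor. *)
Lemma star_conv_continuous : continuous (star_conv f1 f2).
Proof.
move=> g0; apply/cvgrPdist_le => e e0.
have ca : continuous (fun h : G => `|f1 (h^-1)%g|).
  by move=> h; apply: cvg_norm; exact: continuous_invg_comp.
have sa : compactly_supported (fun h : G => `|f1 (h^-1)%g|).
  rewrite /compactly_supported.
  have -> : [set h : G | `|f1 (h^-1)%g| != 0] = [set h : G | f1 (h^-1)%g != 0].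
    by apply/seteqP; split => h /=; rewrite normr_eq0.
  exact: compactly_supported_invg s1.
have ia := Cc_integrable haar_fin ca sa.
pose A := \int[m]_h `|f1 ((h : G)^-1)%g|.
have A0 : 0 <= A by apply: Rintegral_ge0 => h _.
pose d := e / (A + 1).
have d0 : 0 < d by rewrite divr_gt0// ltr_wpDl.
pose Phi (x : G * G) : R := f2 (x.1^-1 * x.2)%g.
have cPhi : continuous Phi.
  move=> x; apply: (@continuous_comp _ _ _ (fun x : G * G => (x.1^-1 * x.2)%g) f2).
    apply: continuous_mulg => y; last exact: cvg_snd.
    apply: (@continuous_comp _ _ _ fst (fun y : G => (y^-1)%g)).
      exact: cvg_fst.
    exact: invg_continuous.
  exact: c2.
have := uniform_near g0 cPhi sa d0.
apply: filterS => g hg.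
rewrite /star_conv -RintegralB//; [|exact: star_conv_integrable|exact: star_conv_integrable].
pose E (h : Borel G) := (f2 ((h : G)^-1 * g0)%g - f2 ((h : G)^-1 * g)%g) *
  f1 ((h : G)^-1)%g.
have iE : m.-integrable setT (EFin \o E).
  apply: Cc_integrable; first exact: haar_fin.
    rewrite (_ : E = fun h : G => f1 (h^-1)%g * f2 (h^-1 * g0)%g -
        f1 (h^-1)%g * f2 (h^-1 * g)%g).
      by apply: continuous_subr; exact: star_conv_integrand_continuous.
    by apply/funext => h; rewrite -mulrBr mulrC.
  by apply: compactly_supportedM; exact: compactly_supported_invg.
rewrite (eq_Rintegral _ (g := E)); last by move=> h _; rewrite -mulrBr mulrC.
apply: le_trans (le_normr_Rintegral _ iE) _ => //.
apply: (@le_trans _ _ (\int[m]_h (d * `|f1 ((h : G)^-1)%g|))).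
  apply: le_Rintegral => //.
  - exact: integrable_norm iE.
  - apply: Cc_integrable; first exact: haar_fin.
      by apply: continuous_mulr => //; exact: continuous_cstr.
    exact: compactly_supportedM sa.
  - move=> h _; rewrite /E normrM.
    have [->|fh] := eqVneq (f1 (h : G)^-1%g) 0; first by rewrite normr0 !mulr0.
    rewrite ler_wpM2r// distrC; apply: ltW; apply: (hg h).
    by apply: subset_closure; rewrite /= normr_eq0.
rewrite RintegralZl// -/A /d mulrAC ler_pdivrMr ?ltr_wpDl//.
by rewrite ler_pM2l// lerDl.
Qed.

End star_conv.
End haar.

(** * Approximate identities *)

Section approximation.
Variables (R : realType) (G : topologicalGroupType).
Hypotheses (hG : hausdorff_space G) (lG : locally_compact [set: G]).
Variable m : {measure set (Borel G) -> \bar R}.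
Hypothesis hm : left_haar m.

Lemma invg_integrable (u : G -> R) : continuous u -> compactly_supported u ->
  m.-integrable setT (EFin \o (fun h : Borel G => u ((h : G)^-1)%g)).
Proof.
move=> cu su; apply: Cc_integrable; first exact: haar_fin.
  exact: continuous_invg_comp.
exact: compactly_supported_invg.
Qed.

Lemma normalized_bump (V : set G) : open V -> V 1%g ->
  exists u : G -> R, [/\ continuous u, compactly_supported u,
    (forall x, 0 <= u x), (forall x, u x != 0 -> V x) &
    \int[m]_h u ((h : G)^-1)%g = 1].
Proof.
move=> oV V1; have [w [cw sw w0 wV w1]] := bump_point R hG lG oV V1.
pose I := \int[m]_h w ((h : G)^-1)%g.
have I0 : 0 < I.
  apply: (@haar_integral_gt0 _ _ hG _ hm (fun h => w (h^-1)%g) 1%g).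
  - exact: continuous_invg_comp.
  - exact: compactly_supported_invg.
  - by move=> y; exact: w0.
  - by rewrite invg1 w1.
exists (fun x => I^-1 * w x); split.
- by apply: continuous_mulr => //; exact: continuous_cstr.
- exact: compactly_supportedM.
- by move=> x; rewrite mulr_ge0// invr_ge0 ltW.
- by move=> x; rewrite mulf_eq0 negb_or => /andP[_ /wV].
- by rewrite RintegralZl//; [rewrite mulVf// gt_eqF|exact: invg_integrable].
Qed.

(** With a normalized [u] supported near 1, the convolution averages the
    translates of [f] by elements near 1, and [f] is uniformly continuous. *)
Lemma star_conv_approx (f : G -> R) (C0 : set G) (e : R) : continuous f ->
  compactly_supported f -> compact C0 -> nbhs 1%g C0 -> 0 < e ->
  exists u : G -> R, [/\ continuous u, compactly_supported u,
    forall x, u x != 0 -> C0 x & forall g, `|star_conv m u f g - f g| <= e].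
Proof.
move=> cf sf cC0 C01 e0.
have cT := compact_inv_mul cC0 sf; set T := [set _ | _ in _] in cT.
pose Phi (x : G * G) : R := f (x.2 * x.1)%g.
have cPhi : continuous Phi.
  move=> x; apply: (@continuous_comp _ _ _ (fun x : G * G => (x.2 * x.1)%g) f).
    by apply: continuous_mulg => y; [exact: cvg_snd|exact: cvg_fst].
  exact: cf.
have : nbhs 1%g (C0 `&` [set w | forall a, T a -> `|Phi (a, w) - Phi (a, 1%g)| < e]).
  exact: filterI C01 (uniform_near 1%g cPhi cT e0).
rewrite nbhsE => -[V [oV V1] VW].
have [u [cu su u0 uV u1]] := normalized_bump oV V1.
have uC x : u x != 0 -> C0 x by move=> /uV /VW[].
exists u; split => // g.
have iu := invg_integrable cu su.
have cuz (z : R) : continuous (fun h : G => z * u (h^-1)%g).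
  by apply: continuous_mulr; [exact: continuous_cstr|exact: continuous_invg_comp].
have suz (z : R) : compactly_supported (fun h : G => z * u (h^-1)%g).
  by apply: compactly_supportedM; exact: compactly_supported_invg.
have iuz (z : R) := Cc_integrable (haar_fin hm) (cuz z) (suz z).
have ic := star_conv_integrable hG hm cu su cf g.
rewrite -[X in _ - X]mulr1 -u1 -RintegralZl// /star_conv -RintegralB//.
pose E (h : Borel G) := (f ((h : G)^-1 * g)%g - f g) * u ((h : G)^-1)%g.
have EE (h : G) : u (h^-1)%g * f (h^-1 * g)%g - f g * u (h^-1)%g = E h.
  by rewrite /E mulrBl [u _ * _]mulrC.
rewrite (eq_Rintegral _ (g := E)); last by move=> h _; exact: EE.
have iE : m.-integrable setT (EFin \o E).
  apply: Cc_integrable; first exact: haar_fin.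
    rewrite (_ : E = fun h : G => u (h^-1)%g * f (h^-1 * g)%g - f g * u (h^-1)%g).
      by apply: continuous_subr => //; exact: star_conv_integrand_continuous.
    by apply/funext => h; rewrite EE.
  by apply: compactly_supportedM; exact: compactly_supported_invg.
apply: le_trans (le_normr_Rintegral _ iE) _ => //.
apply: (@le_trans _ _ (\int[m]_h (e * u ((h : G)^-1)%g))); last first.
  by rewrite RintegralZl// u1 mulr1.
apply: le_Rintegral => //; first exact: integrable_norm iE.
move=> h _; rewrite /E normrM [`|u _|]ger0_norm//.
have [->|uh] := eqVneq (u (h : G)^-1%g) 0; first by rewrite !mulr0.
rewrite ler_wpM2r//.
have [C0h Vh] := VW _ (uV _ uh).
have [Tg|nTg] := pselect (T g).
  have := Vh g Tg; rewrite /Phi /= mul1g; exact: ltW.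
have z (x : G) : C0 x -> f (x * g)%g = 0.
  move=> C0x; apply: contrapT => /eqP fx; apply: nTg.
  exists (x, (x * g)%g); first by split => //; exact: subset_closure.
  by rewrite /= mulKg.
by rewrite z// -[g in f g]mul1g z ?subrr ?normr0 ?ltW//; exact: nbhs_singleton.
Qed.

(** For [b] at least 1 on a compact neighborhood [C0] of 1 and on [C0 * C], the
    integrand of the convolution at a point of [C] is at least 1 on the inverse
    of [C0], where a normalized bump [u] lives. *)
Lemma star_conv_lower_bound (C : set G) : compact C ->
  exists (b : G -> R) (c : R), [/\ continuous b, compactly_supported b,
    (forall x, 0 <= b x), 0 < c & forall g, C g -> c <= star_conv m b b g].
Proof.
move=> cC; have [C0 [C01 cC0 _]] := locally_compact_nbhs 1%g lG.
have [u [cu su u0 uV u1]] :=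
  normalized_bump (@open_interior _ C0) (nbhs_singleton (nbhs_interior C01)).
pose C1 := [set (x.1 * x.2)%g | x in C0 `*` C].
have cC1 : compact C1.
  apply: continuous_compact; last exact: compact_setX.
  apply: continuous_subspaceT; apply: continuous_mulg.
    by move=> x; exact: cvg_fst.
  by move=> x; exact: cvg_snd.
have [b [cb sb b0 b1]] := bump_compact R hG lG (compactU cC0 cC1).
have [M M0 uM] := compact_bounded_fun cu su.
exists b, M^-1; split => //; first by rewrite invr_gt0.
move=> g Cg; rewrite -[M^-1]mulr1 ler_pdivrMl// -u1 /star_conv.
rewrite -RintegralZl//; last exact: star_conv_integrable.
apply: le_Rintegral => //.
- exact: invg_integrable.
- apply: Cc_integrable; first exact: haar_fin.
    apply: continuous_mulr; first exact: continuous_cstr.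
    exact: star_conv_integrand_continuous.
  by apply: compactly_supportedM; exact: star_conv_integrand_supported.
move=> h _ /=; have [->|uh] := eqVneq (u (h : G)^-1%g) 0.
  by apply: mulr_ge0; [exact: ltW|exact: mulr_ge0].
have C0h : C0 (h : G)^-1%g by apply: interior_subset; exact: uV.
apply: (@le_trans _ _ M).
  by apply: le_trans (ler_norm _) _; apply: uM; exact: subset_closure.
rewrite ler_pMr//; apply: mulr_ege1; apply: b1; [by left|right].
by exists ((h : G)^-1%g, g).
Qed.

End approximation.

(** * From complex functions to real functions *)

Section complex_convergence.
Variable R : realType.
Local Notation Re := (@complex.Re R).
Local Notation Im := (@complex.Im R).

Lemma normc_ge_Im (z : R[i]) : (`|Im z|%:C)%C <= `|z|.
Proof.
by rewrite normc_def lecR -sqrtr_sqr ler_wsqrtr// lerDr sqr_ge0.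
Qed.

Lemma normc_le_ReDIm (z : R[i]) : `|z| <= ((`|Re z| + `|Im z|)%:C)%C.
Proof.
rewrite normc_def lecR -[leRHS]ger0_norm ?addr_ge0// -sqrtr_sqr ler_wsqrtr//.
by rewrite sqrrD !real_normK ?num_real// addrAC lerDl mulrn_wge0// mulr_ge0.
Qed.

Variables (T : Type) (F : set_system T).
Context {FF : Filter F}.

Lemma cvg_Re (u : T -> R[i]) (l : R[i]) :
  (u : T -> R[i]^o) @ F --> (l : R[i]^o) -> Re \o u @ F --> Re l.
Proof.
move=> /cvgrPdist_lt h; apply/cvgrPdist_lt => e e0.
have := h (e%:C)%C; rewrite ltcR => /(_ e0).
apply: filterS => t; rewrite -ltcR; apply: le_lt_trans.
by have := normc_ge_Re (l - u t); rewrite raddfB.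
Qed.

Lemma cvg_Im (u : T -> R[i]) (l : R[i]) :
  (u : T -> R[i]^o) @ F --> (l : R[i]^o) -> Im \o u @ F --> Im l.
Proof.
move=> /cvgrPdist_lt h; apply/cvgrPdist_lt => e e0.
have := h (e%:C)%C; rewrite ltcR => /(_ e0).
apply: filterS => t; rewrite -ltcR; apply: le_lt_trans.
by have := normc_ge_Im (l - u t); rewrite raddfB.
Qed.

Lemma cvg_complex (u : T -> R[i]) (l : R[i]) :
  Re \o u @ F --> Re l -> Im \o u @ F --> Im l ->
  (u : T -> R[i]^o) @ F --> (l : R[i]^o).
Proof.
move=> /cvgrPdist_lt hr /cvgrPdist_lt hi; apply/cvgrPdist_lt => e.
rewrite ltcE => /andP[/eqP e1 e0].
have e2 : 0 < Re e / 2 by rewrite divr_gt0.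
apply: filterS2 (hr _ e2) (hi _ e2) => t ht h't.
apply: le_lt_trans (normc_le_ReDIm _) _.
rewrite ltcE e1 eqxx !raddfB/=.
by rewrite (splitr (Re e)) ltrD.
Qed.

End complex_convergence.

Section Cc_real.
Variables (R : realType) (X : topologicalType).

Lemma Cc_Re (f : X -> R[i]) : Cc f ->
  continuous (fun x => complex.Re (f x)) /\
  compactly_supported (fun x => complex.Re (f x)).
Proof.
move=> [cf sf]; split; first by move=> x; exact: cvg_Re (cf x).
apply: (compactly_supported_sub sf); first exact: closed_closure.
move=> x fx; apply: subset_closure => /=; apply: contra_neq fx => ->.
by [].
Qed.

Lemma Cc_Im (f : X -> R[i]) : Cc f ->
  continuous (fun x => complex.Im (f x)) /\
  compactly_supported (fun x => complex.Im (f x)).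
Proof.
move=> [cf sf]; split; first by move=> x; exact: cvg_Im (cf x).
apply: (compactly_supported_sub sf); first exact: closed_closure.
move=> x fx; apply: subset_closure => /=; apply: contra_neq fx => ->.
by [].
Qed.

Lemma Cc_real_complex (f : X -> R) : continuous f -> compactly_supported f ->
  Cc (fun x => (f x)%:C%C).
Proof.
move=> cf sf; split.
  by move=> x; apply: cvg_complex; [exact: cf|exact: cvg_cst].
apply: (compactly_supported_sub sf); first exact: closed_closure.
by move=> x fx; apply: subset_closure => /=; apply: contra_neq fx => ->.
Qed.

End Cc_real.

Lemma fsum_real_complex (R : realType) (T : choiceType) (A : set T) (F : T -> R) :
  \sum_(x \in A) (F x)%:C%C = (\sum_(x \in A) F x)%:C%C.
Proof.
have E : (fun x => (F x)%:C%C) @^-1` [set~ 0] = F @^-1` [set~ 0].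
  apply/seteqP; split => x /=; first by move=> h Fx; apply: h; rewrite Fx.
  by move=> h Fx; apply: h; apply: complexI.
have -> : finite_support 0 A (fun x => (F x)%:C%C) = finite_support 0 A F.
  by rewrite /finite_support !unlock E.
by rewrite rmorph_sum.
Qed.

Lemma locally_compact_prod (G H : topologicalType) :
  locally_compact [set: G] -> locally_compact [set: H] ->
  locally_compact [set: (G * H)%type].
Proof.
move=> lG lH x _; rewrite withinET.
have [C [Cx cC kC]] := locally_compact_nbhs x.1 lG.
have [D [Dx cD kD]] := locally_compact_nbhs x.2 lH.
exists (C `*` D); first by exists (C, D).
split; first exact: compact_setX.
have -> : C `*` D = (fst @^-1` C) `&` (snd @^-1` D) by [].
apply: closedI; apply: preimage_closed => // y _.
  exact: cvg_fst.
exact: cvg_snd.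
Qed.

Lemma hausdorff_prod (G H : topologicalType) :
  hausdorff_space G -> hausdorff_space H -> hausdorff_space (G * H)%type.
Proof.
move=> hG hH [a b] [c d] cl.
have -> : a = c.
  apply: hG => A C Aa Cc; have [||[x y] [[Ax _] [Cx _]]] := cl (A `*` setT) (C `*` setT).
  - by exists (A, setT) => //; split => //=; exact: filterT.
  - by exists (C, setT) => //; split => //=; exact: filterT.
  - by exists x.
congr pair; apply: hH => A C Aa Cc.
have [||[x y] [[_ Ax] [_ Cx]]] := cl (setT `*` A) (setT `*` C).
- by exists (setT, A) => //; split => //=; exact: filterT.
- by exists (setT, C) => //; split => //=; exact: filterT.
- by exists y.
Qed.

Section real_autocorrelation.
Variables (R : realType) (G H : topologicalGroupType) (U K : set (G * H)).
Variable v : H -> R.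

Definition rperiod (f : G -> R) (D : delone U K) : R :=
  psum (fun x : G * H => f x.1 * v x.2) D.

Lemma periodization_real (f : G -> R) (D : delone U K) :
  periodization v (fun g => (f g)%:C%C) (cset (val D)) = (rperiod f D)%:C%C.
Proof.
rewrite /periodization /rperiod /psum -fsum_real_complex.
by apply: eq_fsbigr => x _; rewrite rmorphM.
Qed.

Lemma autocorrelation_real (m gamma : {measure set (Borel G) -> \bar R})
    (Om : invariant_closed U K) (mu : probability (Borel (points Om)) R)
    (f1 f2 : G -> R) : autocorrelation m v mu gamma ->
  continuous f1 -> compactly_supported f1 ->
  continuous f2 -> compactly_supported f2 ->
  \int[gamma]_g star_conv m f1 f2 g =
  \int[mu]_D on_points (fun D => rperiod f1 D * rperiod f2 D) D.
Proof.
move=> [_ _ ac] c1 s1 c2 s2.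
have := ac _ _ (Cc_real_complex c1 s1) (Cc_real_complex c2 s2).
move=> /(congr1 (@complex.Re R)); rewrite /cintegral /=.
have -> : (fun g : Borel G => complex.Re (convolution m
    (involution (fun x => (f1 x)%:C%C)) (fun x => (f2 x)%:C%C) g)) =
    (star_conv m f1 f2 : Borel G -> R).
  apply/funext => g; rewrite /convolution /cintegral /= /star_conv /involution.
  by apply: eq_Rintegral => h _; rewrite /= mulr0 subr0.
move=> ->; apply: eq_Rintegral => D _.
rewrite /points_set !periodization_real /= /on_points.
by rewrite mulr0 subr0.
Qed.

Lemma rperiod_continuous (f : G -> R) : hausdorff_space G -> hausdorff_space H ->
  locally_compact [set: G] -> locally_compact [set: H] -> open U -> U 1%g ->
  window v -> continuous f -> compactly_supported f -> continuous (rperiod f).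
Proof.
move=> hG hH lG lH oU U1 [cv sv _] cf sf.
apply: psum_continuous => //.
- exact: hausdorff_prod.
- exact: locally_compact_prod.
- apply: continuous_mulr => x.
    by apply: continuous_comp; [exact: cvg_fst|exact: cf].
  by apply: continuous_comp; [exact: cvg_snd|exact: cv].
- have cC := compact_setX sf sv.
  apply: (compactly_supported_sub cC).
    by apply: compact_closed => //; exact: hausdorff_prod.
  move=> x; rewrite mulf_eq0 negb_or => /andP[fx vx].
  by split; exact: subset_closure.
Qed.

End real_autocorrelation.

(** * Convergence of autocorrelations *)

Lemma real_weak_star_cvg (R : realType) (G H : topologicalGroupType)
  (hG : lcsc_hausdorff G) (hH : lcsc_hausdorff H)
  (mG : {measure set (Borel G) -> \bar R}) (hmG : left_haar mG)
  (U K : set (G * H)) (oU : open U) (U1 : U 1%g) (cK : compact K)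
  (Om : invariant_closed U K) (mu : probability (Borel (points Om)) R)
  (ue : uniquely_ergodic mu) (v : H -> R) (hv : window v)
  (Om_ : nat -> invariant_closed U K)
  (mu_ : forall l, probability (Borel (points (Om_ l))) R)
  (inv_ : forall l, G_invariant (mu_ l)) (cvgOm : Om_ @ \oo --> Om)
  (gamma : {measure set (Borel G) -> \bar R})
  (gamma_ : nat -> {measure set (Borel G) -> \bar R})
  (hgamma : autocorrelation mG v mu gamma)
  (hgamma_ : forall l, autocorrelation mG v (mu_ l) (gamma_ l)) (f : G -> R) :
  continuous f -> compactly_supported f ->
  (fun l => \int[gamma_ l]_g f g) @ \oo --> \int[gamma]_g f g.
Proof.
move=> cf sf.
have [lG _ tG] := hG; have [lH _ tH] := hH.
have tL := hausdorff_prod tG tH; have lL := locally_compact_prod lG lH.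
have cX := @delone_compact _ U K tL oU cK.
have cp u := rperiod_continuous (K := K) tG tH lG lH oU U1 hv (f := u).
pose Phi (a b : G -> R) (D : delone U K) : R := rperiod v a D * rperiod v b D.
have cPhi a b : continuous a -> compactly_supported a -> continuous b ->
    compactly_supported b -> continuous (Phi a b).
  by move=> ca sa cb sb; apply: continuous_mulr; exact: cp.
have [C0 [C01 cC0 _]] := locally_compact_nbhs 1%g lG.
have cT := compact_inv_mul cC0 sf; set T := [set _ | _ in _] in cT.
have [b [c [cb sb b0 c0 bT]]] := star_conv_lower_bound tG lG hmG cT.
pose B := star_conv mG b b.
have cB : continuous B by exact: star_conv_continuous.
have sB : compactly_supported B by exact: star_conv_supported.
have [M M0 PM] := compact_bounded_fun (cPhi _ _ cb sb cb sb) cX.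
(* The bound [M] on the square of the periodization of [b] does not depend on
   the system, so that the error is uniform. *)
have key (Om' : invariant_closed U K) (mu' : probability (Borel (points Om')) R)
    (ga : {measure set (Borel G) -> \bar R}) (u : G -> R) (e : R) :
    autocorrelation mG v mu' ga -> continuous u -> compactly_supported u ->
    (forall x, u x != 0 -> C0 x) -> 0 < e ->
    (forall g, `|star_conv mG u f g - f g| <= e) ->
    `|\int[ga]_g f g - \int[mu']_D on_points (Phi u f) D| <= e / c * M.
  move=> ac cu su uC e0 uf.
  have [[gfin _ _] _ _] := ac.
  have ci (h : G -> R) : continuous h -> compactly_supported h ->
      ga.-integrable setT (EFin \o (h : Borel G -> R)).
    by move=> ch sh; exact: Cc_integrable.
  have cuf := star_conv_continuous tG hmG cu su cf.
  have suf : compactly_supported (star_conv mG u f) by exact: star_conv_supported.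
  rewrite -(autocorrelation_real ac)// -RintegralB//; [|exact: ci|exact: ci].
  pose E (g : G) := f g - star_conv mG u f g.
  have cE : continuous E by exact: continuous_subr.
  have sE : compactly_supported E.
    apply: (compactly_supported_sub cT); first exact: compact_closed.
    move=> g; have [fg|fg _] := eqVneq (f g) 0.
      rewrite /E fg sub0r oppr_eq0 => ug.
      by apply: (star_conv_supp uC _ ug) => x fx; exact: subset_closure.
    exists (1%g, g); last by rewrite /= invg1 mul1g.
    by split; [exact: nbhs_singleton|exact: subset_closure].
  have EB g : `|E g| <= e / c * B g.
    have [Tg|nTg] := pselect (T g).
      rewrite -mulrA -[leLHS]mulr1; apply: ler_pM => //.
        by rewrite /E distrC.
      by rewrite mulrC ler_pdivlMr// mul1r; exact: bT.
    have -> : E g = 0.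
      apply/eqP; apply: contraT => Eg; case: nTg.
      have [fg|fg] := eqVneq (f g) 0.
        move: Eg; rewrite /E fg sub0r oppr_eq0 => ug.
        by apply: (star_conv_supp uC _ ug) => x fx; exact: subset_closure.
      exists (1%g, g); last by rewrite /= invg1 mul1g.
      by split; [exact: nbhs_singleton|exact: subset_closure].
    rewrite normr0; apply: mulr_ge0; last exact: star_conv_ge0.
    by rewrite divr_ge0// ltW.
  apply: le_trans (le_normr_Rintegral _ (ci _ cE sE)) _ => //.
  apply: (@le_trans _ _ (\int[ga]_g (e / c * B g))).
    apply: le_Rintegral => //.
    - exact: integrable_norm (ci _ cE sE).
    - apply: ci; last exact: compactly_supportedM.
      by apply: continuous_mulr => //; exact: continuous_cstr.
  rewrite RintegralZl; [|exact: measurableT|exact: ci].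
  apply: ler_wpM2l; first by rewrite divr_ge0// ltW.
  rewrite /B (autocorrelation_real ac)//.
  have cP := points_compact tL oU cK (Om := Om').
  have cr := on_points_continuous (cPhi _ _ cb sb cb sb) (Om := Om').
  apply: (@le_trans _ _ (\int[mu']_D M)).
    apply: le_Rintegral => //.
    - exact: continuous_integrable.
    - by apply: continuous_integrable => //; exact: continuous_cstr.
    - by move=> D _; apply: le_trans (ler_norm _) _; exact: PM.
  by rewrite Rintegral_cst// [X in fine X]probability_setT mulr1.
apply/cvgrPdist_le => eta eta0.
(* The error [e / c * M] of [key] becomes a third of [eta]. *)
pose e := eta / 3 / (M / c).
have e0 : 0 < e by rewrite !divr_gt0.
have ecM : e / c * M = eta / 3.
  by rewrite mulrAC -mulrA /e divfK// gt_eqF// divr_gt0.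
have [u [cu su uC uf]] := star_conv_approx tG lG hmG cf sf cC0 C01 e0.
have ac := mean_cvg tL lL oU cK cvgOm inv_ ue (cPhi _ _ cu su cf sf).
have eta3 : 0 < eta / 3 by rewrite divr_gt0.
move/cvgrPdist_le : ac => /(_ _ eta3); apply: filterS => l hl.
have h1 := key _ _ _ _ _ hgamma cu su uC e0 uf.
have h2 := key _ _ _ _ _ (hgamma_ l) cu su uC e0 uf.
rewrite ecM in h1 h2; rewrite /mean in hl.
move: hl h1 h2; set I0 := \int[mu]_D _; set Il := \int[mu_ l]_D _.
set J0 := \int[gamma]_g _; set Jl := \int[gamma_ l]_g _.
rewrite !ler_norml => /andP[? ?] /andP[? ?] /andP[? ?].
by apply/andP; split; lra.
Qed.

Theorem theorem2 (R : realType) (G H : topologicalGroupType)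
  (hG : lcsc_hausdorff G) (hH : lcsc_hausdorff H)
  (uG : unimodular R G) (uH : unimodular R H)
  (mG : {measure set (Borel G) -> \bar R}) (hmG : left_haar mG)
  (U K : set (G * H)) (oU : open U) (U1 : U 1%g) (cK : compact K)
  (Om : invariant_closed U K) (mu : probability (Borel (points Om)) R)
  (ue : uniquely_ergodic mu)
  (v : H -> R) (hv : window v)
  (Om_ : nat -> invariant_closed U K)
  (mu_ : forall l, probability (Borel (points (Om_ l))) R)
  (inv_ : forall l, G_invariant (mu_ l))
  (cvgOm : Om_ @ \oo --> Om)
  (gamma : {measure set (Borel G) -> \bar R})
  (gamma_ : nat -> {measure set (Borel G) -> \bar R})
  (hgamma : autocorrelation mG v mu gamma)
  (hgamma_ : forall l, autocorrelation mG v (mu_ l) (gamma_ l)) :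
  weak_star_cvg gamma_ gamma.
Proof.
move=> f Cf; have [cr sr] := Cc_Re Cf; have [ci si] := Cc_Im Cf.
apply: cvg_complex; rewrite /cintegral /=.
  exact: (real_weak_star_cvg hG hH hmG oU U1 cK ue hv inv_ cvgOm hgamma hgamma_).
exact: (real_weak_star_cvg hG hH hmG oU U1 cK ue hv inv_ cvgOm hgamma hgamma_).
Qed.
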